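(* Let $\omega>0$ and $$\varphi_\omega(x)=\frac{2\sqrt{2\omega}}{e^{\sqrt{\omega}\,x}+e^{-\sqrt{\omega}\,x}},\qquad x\in\mathbb{R}.$$ For every $\epsilon>0$ there exists $q_{\omega,\epsilon}\in H^1(\mathbb{R})$ such that $$\|\varphi_\omega-q_{\omega,\epsilon}\|_{H^1(\mathbb{R})}<\epsilon$$ and the solution of $$iu_t(t,x)+u_{xx}(t,x)+u^2(t,x)\,\overline{u}(t,-x)=0$$ with initial data $u(0,\cdot)=q_{\omega,\epsilon}$ blows up in finite time.
   Context: Functions are complex-valued, and $\overline{u}(t,-x)$ denotes the complex conjugate of $u(t,-x)$. Let $S(t)=e^{it\partial_x^2}$ be the free Schrödinger group on $\mathbb{R}$ and $F(u)(x)=u^2(x)\overline{u}(-x)$. For $0<T\le\infty$, a solution on $[0,T)$ with initial data $u_0\in H^1(\mathbb{R})$ is a function $u\in C([0,T),H^1(\mathbb{R}))$ satisfying $$u(t)=S(t)u_0+i\int_0^t S(t-s)F(u(s))\,ds,\qquad t\in[0,T)$$ (equivalently, the equation holds in $H^{-1}(\mathbb{R})$ with $u(0)=u_0$). For every $u_0\in H^1(\mathbb{R})$ there is a unique maximal (non-extendable) such solution, defined on some interval $[0,T_{\max})$ with $T_{\max}\in(0,\infty]$; ''the solution'' refers to this one. It ''blows up in finite time'' if $T_{\max}<\infty$ and $\limsup_{t\to T_{\max}^-}\|u(t,\cdot)\|_{L^\infty(\mathbb{R})}=\infty$. *)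

(* Defs.v *)
From HB Require Import structures.
From mathcomp Require Import all_boot all_order all_algebra.
From mathcomp Require Import all_classical all_reals all_analysis.
From mathcomp Require Import complex.

Set Implicit Arguments.
Unset Strict Implicit.
Unset Printing Implicit Defensive.

Import Order.TTheory GRing.Theory Num.Theory.
Import numFieldNormedType.Exports.

Local Open Scope classical_set_scope.
Local Open Scope ring_scope.

(* Elements of L2 and H1 are represented by functions R -> R[i]; equality of
   elements is equality almost everywhere. *)

Definition cabs (R : realType) (f : R -> R[i]) (x : R) : \bar R :=
  (Normc.normc (f x))%:E.

Definition cintegral (R : realType) (f : R -> R[i]) : R[i] :=
  Complex (\int[@lebesgue_measure R]_x complex.Re (f x))
          (\int[@lebesgue_measure R]_x complex.Im (f x)).

Definition L2 (R : realType) (f : R -> R[i]) : Prop :=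
  (fun x => complex.Re (f x)) \in Lfun (@lebesgue_measure R) 2%:E /\
  (fun x => complex.Im (f x)) \in Lfun (@lebesgue_measure R) 2%:E.

Definition L2norm (R : realType) (f : R -> R[i]) : R :=
  fine ('N[@lebesgue_measure R]_(2%:E)[cabs f]).

Definition Linfnorm (R : realType) (f : R -> R[i]) : \bar R :=
  'N[@lebesgue_measure R]_(+oo%E)[cabs f]%E.

(* Compactly supported functions of class C^1, the usual test functions for
   Sobolev spaces on the line. Real test functions suffice. *)
Definition test_fun (R : realType) (phi : R -> R) : Prop :=
  [/\ forall x, derivable phi x 1,
      continuous (phi^`())%classic
    & exists M : R, forall x, M < `|x| -> phi x = 0].

Definition is_weak_derivative (R : realType) (f g : R -> R[i]) : Prop :=
  forall phi : R -> R, test_fun phi ->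
    cintegral (fun x => f x * real_complex R (phi^`()%classic x)) =
    - cintegral (fun x => g x * real_complex R (phi x)).

Definition H1 (R : realType) (f : R -> R[i]) : Prop :=
  L2 f /\ exists g : R -> R[i], L2 g /\ is_weak_derivative f g.

(* A representative of the weak derivative, unique almost everywhere when f is
   in H1; meaningless otherwise. *)
Definition wderiv (R : realType) (f : R -> R[i]) : R -> R[i] :=
  xget (fun=> 0) [set g | L2 g /\ is_weak_derivative f g].

Definition H1norm (R : realType) (f : R -> R[i]) : R :=
  Num.sqrt (L2norm f ^+ 2 + L2norm (wderiv f) ^+ 2).

(* H^{-1} is the dual of H1: its elements are functionals on H1. Functions and
   second derivatives are embedded through the bilinear (unconjugated)
   pairing, so that the embedding is complex linear. *)
Definition Hm1_of_fun (R : realType) (f v : R -> R[i]) : R[i] :=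
  cintegral (fun x => f x * v x).

Definition Hm1_dxx (R : realType) (f v : R -> R[i]) : R[i] :=
  - cintegral (fun x => wderiv f x * wderiv v x).

Definition Hm1norm (R : realType) (l : (R -> R[i]) -> R[i]) : \bar R :=
  ereal_sup [set (Normc.normc (l v))%:E
            | v in [set v | H1 v /\ H1norm v <= 1]].

Definition time_interval (R : realType) (T : \bar R) : set R :=
  [set t | 0 <= t /\ (t%:E < T)%E].

Definition continuous_H1 (R : realType) (T : \bar R) (u : R -> R -> R[i])
  : Prop :=
  (forall t, time_interval T t -> H1 (u t)) /\
  (forall t, time_interval T t ->
     H1norm (u s \- u t) @[s --> within (time_interval T) (nbhs t)]
       --> (0 : R)).

(* [l] is the derivative of [u] at [t] for the norm of H^{-1}, as a function on
   the interval [0, T[ (hence one-sided at 0). *)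
Definition is_Hm1_derivative (R : realType) (T : \bar R) (u : R -> R -> R[i])
    (t : R) (l : (R -> R[i]) -> R[i]) : Prop :=
  Hm1norm (fun v =>
      real_complex R (s - t)^-1 * Hm1_of_fun (u s \- u t) v - l v)
    @[s --> within (time_interval T) t^'] --> 0%E.

Definition nonlinearity (R : realType) (f : R -> R[i]) (x : R) : R[i] :=
  f x ^+ 2 * conjc (f (- x)).

(* i u_t + u_xx + F(u) = 0 in H^{-1} at every time of [0, T[; for u in
   C([0, T[, H1) this is equivalent to Duhamel's formula. *)
Definition is_solution (R : realType) (u0 : R -> R[i]) (T : \bar R)
    (u : R -> R -> R[i]) : Prop :=
  [/\ (0 < T)%E,
      continuous_H1 T u,
      u 0 = u0 %[ae @lebesgue_measure R]
    & forall t, time_interval T t ->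
        exists ut : (R -> R[i]) -> R[i],
          is_Hm1_derivative T u t ut /\
          forall v, H1 v ->
            Complex 0 1 * ut v + Hm1_dxx (u t) v
              + Hm1_of_fun (nonlinearity (u t)) v = 0].

(* Not extendable to a longer time interval; the Cauchy problem in H1 being
   well-posed, each u0 in H1 has exactly one maximal solution. *)
Definition is_maximal_solution (R : realType) (u0 : R -> R[i]) (T : \bar R)
    (u : R -> R -> R[i]) : Prop :=
  is_solution u0 T u /\
  ~ exists (T' : \bar R) (v : R -> R -> R[i]),
      [/\ (T < T')%E, is_solution u0 T' v
        & forall t, time_interval T t ->
            v t = u t %[ae @lebesgue_measure R]].

Definition blows_up_at (R : realType) (T : \bar R) (u : R -> R -> R[i])
  : Prop :=
  (T < +oo)%E /\
  limf_esup (fun t => Linfnorm (u t)) ((fine T)^'-) = +oo%E.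

Definition soliton (R : realType) (omega : R) (x : R) : R[i] :=
  real_complex R (2 * Num.sqrt (2 * omega)
    / (expR (Num.sqrt omega * x) + expR (- (Num.sqrt omega * x)))).

(* Main.v *)
(** The equation is integrable, and the soliton e^{i omega t} phi_omega can be
    boosted with an imaginary velocity: for 0 < al < be put
      P(t,x) = e^{al x - i al^2 t},   Q(t,x) = e^{- be x - i be^2 t},
      u = A / (P + Q)  with  A^2 = 2 (al + be)^2.
    The conjugate of u(t,-x) is A P Q / (P + Q), and a direct computation shows
    that u solves the equation wherever P + Q has no zero.  Since
      |P + Q|^2 = (|P| + |Q|)^2 cos^2 th + (|P| - |Q|)^2 sin^2 th
    with th = (be^2 - al^2) t / 2, the first zero appears at x = 0 when
    th = pi / 2; near that time |u| >= k / cos th on [0, cos th], so both the sup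
    norm and the L2 norm blow up.  Blow-up of the L2 norm excludes any extension,
    hence u is maximal and no uniqueness theorem is needed.  For al = a - d and
    be = a + d with a^2 = omega, the initial datum is e^{dx} phi_omega(x), which
    tends to phi_omega in H^1 as d tends to 0.

    All functions of x that occur are bounded by multiples of 1 / (1 + x^2),
    which serves as a universal integrable and square-integrable majorant. *)

Require Import Defs.
From mathcomp Require Import all_boot all_order all_algebra.
From mathcomp Require Import all_classical all_reals all_analysis.
From mathcomp Require Import measurable_realfun complex ring lra.

Set Implicit Arguments.
Unset Strict Implicit.
Unset Printing Implicit Defensive.

Import Order.TTheory GRing.Theory Num.Theory.
Import numFieldNormedType.Exports.

Local Open Scope classical_set_scope.
Local Open Scope ring_scope.

(** * Square-integrable real functions *)

Section real_L2.
Context {R : realType}.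
Notation mu := (@lebesgue_measure R).
Implicit Types (f g h : R -> R).

(** With v(t,x) the conjugate of u(t,-x), the equation is one half of the system i u_t + u_xx + u^2
    v = 0, - i v_t + v_xx + v^2 u = 0, whose one-soliton has two independent exponents al and be.
    For al = be the phases of P and Q agree for ever and u is the standing soliton. For al < be they
    drift apart and P + Q cancels at x = 0, where |P| = |Q|. With al = a - d and be = a + d this
    happens at time pi / (4 a d), finite for every d > 0 but unbounded as d tends to 0. The H^{-1}
    formulation shapes the analysis: it tests against an arbitrary v in H^1, and [wderiv] is a mere
    choice among weak derivatives. This calls for uniqueness of weak derivatives almost everywhere,
    and for integration by parts of a C^1 function without compact support against v. Estimates in
    time must be uniform in x: near a time before blow-up, cos th stays above some c > 0, and u is A
    / (|P| + |Q|), which carries the decay in x, times a bounded Lipschitz function of time. *)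

Lemma integrable_oneDsqrV :
  mu.-integrable setT (EFin \o (fun x : R => (oneDsqr x)^-1)).
Proof.
apply/integrableP; split.
  apply/measurable_EFinP; apply: continuous_measurable_fun.
  exact: continuous_oneDsqrV.
under eq_integral => x _ do rewrite /= ger0_norm ?invr_ge0 ?(le_trans ler01)//.
rewrite ge0_symfun_integralT//.
- rewrite -set_itvcy integral0y_oneDsqr -EFinM; exact: ltry.
- exact: continuous_oneDsqrV.
- by move=> x; rewrite /= /oneDsqr sqrrN.
Qed.

Lemma Lfun2P f : f \in Lfun mu 2%:E <->
  measurable_fun setT f /\ mu.-integrable setT (EFin \o (fun x => f x ^+ 2)).
Proof.
split=> [f2|[mf if2]].
  split; last exact: Lfun2_integrable_sqr.
  by move: f2; rewrite inE => /andP[/[!inE]/= mf _].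
rewrite inE; apply/andP; split; rewrite inE//= /finite_norm unlock.
apply: poweR_lty; case/integrableP: if2 => _; apply: le_lt_trans.
rewrite le_eqVlt; apply/orP; left; apply/eqP.
by apply: eq_integral => x _; rewrite /= normrX powR_mulrn.
Qed.

Lemma integrable_mul f g : f \in Lfun mu 2%:E -> g \in Lfun mu 2%:E ->
  mu.-integrable setT (EFin \o (fun x => f x * g x)).
Proof. by move=> f2 g2; apply/Lfun1_integrable; exact: Lfun2_mul_Lfun1. Qed.

Lemma le_Rintegrable f g : measurable_fun setT f ->
  (forall x, `|f x| <= g x) ->
  mu.-integrable setT (EFin \o g) -> mu.-integrable setT (EFin \o f).
Proof.
move=> mf fg; apply: le_integrable => //; first exact/measurable_EFinP.
by move=> x _ /=; rewrite lee_fin (le_trans (fg x))// ler_norm.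
Qed.

Lemma integrable_ZoneDsqrV (K : R) :
  mu.-integrable setT (EFin \o (fun x : R => K * (oneDsqr x)^-1)).
Proof.
have := @integrableZl _ _ _ mu _ measurableT K _ integrable_oneDsqrV.
by apply: eq_integrable => // x _ /=; rewrite EFinM.
Qed.

(** The weight 1 / (1 + x^2) is at most 1, hence bounds its own square. *)
Lemma Lfun2_le_oneDsqrV f (K : R) : measurable_fun setT f ->
  (forall x, `|f x| <= K * (oneDsqr x)^-1) -> f \in Lfun mu 2%:E.
Proof.
move=> mf fK; apply/Lfun2P; split => //.
apply: (@le_Rintegrable _ (fun x => K ^+ 2 * (oneDsqr x)^-1))
  (integrable_ZoneDsqrV _).
  exact: measurable_funX.
move=> x; rewrite normrX (le_trans (lerXn2r 2 _ _ (fK x))) ?nnegrE//.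
  exact: le_trans (fK x).
rewrite exprMn ler_wpM2l ?sqr_ge0// exprS ler_piMr ?invr_ge0 ?(le_trans
  ler01)//.
exact: oneDsqrV_le1.
Qed.

Lemma Lfun2D f g : f \in Lfun mu 2%:E -> g \in Lfun mu 2%:E ->
  (fun x => f x + g x) \in Lfun mu 2%:E.
Proof.
have h2 : (1 <= 2%:E :> \bar R)%E by rewrite lee_fin ler1n.
exact: (Lfun_addr_closed mu h2).2.
Qed.

Lemma Lfun2N f : f \in Lfun mu 2%:E -> (fun x => - f x) \in Lfun mu 2%:E.
Proof.
move=> /Lfun2P[mf if2]; apply/Lfun2P; split; first exact: measurableT_comp.
by apply: eq_integrable if2 => // x _ /=; rewrite sqrrN.
Qed.

Lemma Lfun2B f g : f \in Lfun mu 2%:E -> g \in Lfun mu 2%:E ->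
  (fun x => f x - g x) \in Lfun mu 2%:E.
Proof. by move=> f2 g2; apply: Lfun2D => //; exact: Lfun2N. Qed.

Lemma Lfun2Z (k : R) f : f \in Lfun mu 2%:E ->
  (fun x => k * f x) \in Lfun mu 2%:E.
Proof.
move=> /Lfun2P[mf if2]; apply/Lfun2P; split; first exact: measurable_funM.
have := @integrableZl _ _ _ mu _ measurableT (k ^+ 2) _ if2.
by apply: eq_integrable => // x _ /=; rewrite exprMn EFinM.
Qed.

Lemma Lfun2_meas f : f \in Lfun mu 2%:E -> measurable_fun setT f.
Proof. by case/Lfun2P. Qed.

Lemma Lfun2_0 : (fun=> 0) \in Lfun mu 2%:E.
Proof.
apply: (@Lfun2_le_oneDsqrV _ 0); first exact: measurable_cst.
by move=> x; rewrite normr0 mul0r.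
Qed.

End real_L2.

Section complex_L2.
Context {R : realType}.
Notation mu := (@lebesgue_measure R).
Implicit Types (f g h : R -> R[i]).

Definition cabs2 f (x : R) : R := complex.Re (f x) ^+ 2 + complex.Im (f x) ^+ 2.

Lemma cabs2_ge0 f x : 0 <= cabs2 f x.
Proof. by rewrite addr_ge0 ?sqr_ge0. Qed.

Lemma sqr_Normc (z : R[i]) :
  Normc.normc z ^+ 2 = complex.Re z ^+ 2 + complex.Im z ^+ 2.
Proof. by case: z => a b /=; rewrite sqr_sqrtr// addr_ge0 ?sqr_ge0. Qed.

Lemma normc_ge0 (z : R[i]) : 0 <= Normc.normc z.
Proof. by case: z => a b; exact: sqrtr_ge0. Qed.

Lemma integrable_cabs2 f : L2 f -> mu.-integrable setT (EFin \o cabs2 f).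
Proof.
case=> /Lfun2_integrable_sqr f1 /Lfun2_integrable_sqr f2.
have := integrableD measurableT f1 f2.
by apply: eq_integrable => // x _ /=; rewrite -EFinD.
Qed.

Lemma L2norm_ge0 f : 0 <= L2norm f.
Proof. by rewrite fine_ge0// Lnorm_ge0. Qed.

(** Squaring removes both the root in the modulus and the exponent 1/2 of the norm; the estimates of
    L2 norms below use this form. *)
Lemma sqr_L2norm f : L2 f -> L2norm f ^+ 2 = \int[mu]_x cabs2 f x.
Proof.
move=> f2; have i2 := integrable_cabs2 f2.
rewrite /L2norm /Rintegral unlock.
under eq_integral => x _.
  rewrite /cabs abse_EFin poweR_EFin.
  rewrite (ger0_norm (normc_ge0 _)) powR_mulrn ?normc_ge0// sqr_Normc.
  over.
have ifin : (\int[mu]_x (cabs2 f x)%:E)%E \is a fin_num.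
  exact: integrable_fin_num.
rewrite -[in LHS](fineK ifin) poweR_EFin /= powR12_sqrt; last first.
  by apply: Rintegral_ge0 => x _; exact: cabs2_ge0.
by rewrite sqr_sqrtr// fine_ge0// integral_ge0// => x _;
  rewrite lee_fin cabs2_ge0.
Qed.

End complex_L2.

(** * Weak derivatives *)

Section derivation_rules.
Context {R : realType}.
Implicit Types (f g : R -> R) (x a b : R).

Lemma is_derive_addf f g x a b : is_derive x 1 f a -> is_derive x 1 g b ->
  is_derive x 1 (fun y => f y + g y) (a + b).
Proof. exact: is_deriveD. Qed.

Lemma is_derive_subf f g x a b : is_derive x 1 f a -> is_derive x 1 g b ->
  is_derive x 1 (fun y => f y - g y) (a - b).
Proof. exact: is_deriveB. Qed.

Lemma is_derive_oppf f x a : is_derive x 1 f a ->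
  is_derive x 1 (fun y => - f y) (- a).
Proof. exact: is_deriveN. Qed.

Lemma is_derive_mulf f g x a b : is_derive x 1 f a -> is_derive x 1 g b ->
  is_derive x 1 (fun y => f y * g y) (a * g x + f x * b).
Proof.
move=> fa gb; apply: is_derive_eq (is_deriveM fa gb) _.
by rewrite addrC /GRing.scale /= mulrC.
Qed.

Lemma is_derive_invf f x a : f x != 0 -> is_derive x 1 f a ->
  is_derive x 1 (fun y => (f y)^-1) (- a / f x ^+ 2).
Proof.
move=> fx0 fa; apply: is_derive_eq (is_deriveV fx0 fa) _.
by rewrite /GRing.scale /= mulrC mulrN mulNr.
Qed.

Lemma is_derive_compf f g x a b : is_derive (g x) 1 f a -> is_derive x 1 g b ->
  is_derive x 1 (fun y => f (g y)) (a * b).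
Proof. exact: is_derive1_comp. Qed.

Lemma is_derive_cstf a x : is_derive x 1 (fun=> a) 0.
Proof. exact: is_derive_cst. Qed.

Lemma is_derive_idf x : is_derive x 1 (fun y : R => y) 1.
Proof. exact: is_derive_id. Qed.

Lemma is_derive_continuous f f' : (forall x, is_derive x 1 f (f' x)) ->
  continuous f.
Proof.
move=> ff' x; apply/differentiable_continuous/derivable1_diffP.
by case: (ff' x).
Qed.

Lemma is_derive_derive1 f f' : (forall x, is_derive x 1 f (f' x)) ->
  (f^`())%classic = f'.
Proof. by move=> ff'; apply/funext => x; rewrite derive1E; case: (ff' x). Qed.

End derivation_rules.

(** * A C^1 building block for compactly supported functions *)

Section positive_part.
Context {R : realType}.
Implicit Types x y : R.

Definition pospart y : R := (y + `|y|) / 2.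

Lemma ge0_pospart y : 0 <= y -> pospart y = y.
Proof. by move=> y0; rewrite /pospart ger0_norm//; field. Qed.

Lemma le0_pospart y : y <= 0 -> pospart y = 0.
Proof. by move=> y0; rewrite /pospart ler0_norm// subrr mul0r. Qed.

Lemma pospart_ge0 y : 0 <= pospart y.
Proof.
by have [y0|/ltW y0] := leP 0 y; [rewrite ge0_pospart|rewrite le0_pospart].
Qed.

Lemma continuous_pospart : continuous pospart.
Proof.
by move=> y; apply: cvgMr_tmp; apply: cvgD;
  [exact: cvg_id|exact: norm_continuous].
Qed.

(** At 0 the difference quotient of the square is [pospart] itself, continuous and zero there: this
    is Caratheodory's criterion. *)
Lemma is_derive_pospart2 y :
  is_derive y 1 (fun x => pospart x ^+ 2) (2 * pospart y).
Proof.
have [y0|y0|<-] := ltgtP 0 y.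
- apply: (@near_eq_is_derive _ _ _ (fun x => x * x)).
    have h := lt_nbhsr y0.
    by near=> x; rewrite ge0_pospart ?expr2//; apply/ltW; near: x.
  apply: is_derive_eq (is_derive_mulf (is_derive_idf y) (is_derive_idf y)) _.
  by rewrite ge0_pospart ?ltW//; ring.
- apply: (@near_eq_is_derive _ _ _ (fun x => 0)).
    have h := lt_nbhsl y0.
    by near=> x; rewrite le0_pospart ?expr0n//; apply/ltW; near: x.
  by rewrite le0_pospart ?ltW// mulr0; exact: is_derive_cst.
- apply/is_derive1_caratheodory; exists pospart; split.
  + move=> z; rewrite subr0 [pospart 0]le0_pospart// expr0n subr0.
    have [z0|/ltW z0] := leP 0 z; first by rewrite ge0_pospart// expr2.
    by rewrite le0_pospart// expr0n mul0r.
  + exact: continuous_pospart.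
  + by rewrite le0_pospart// mulr0.
Unshelve. all: by end_near. Qed.

End positive_part.

(** * Integration by parts against test functions; dominated convergence *)

Section weak_derivative.
Context {R : realType}.
Notation mu := (@lebesgue_measure R).
Implicit Types (f g h phi dphi : R -> R) (x : R).

Lemma test_funP phi dphi (M : R) : (forall x, is_derive x 1 phi (dphi x)) ->
  continuous dphi -> (forall x, M < `|x| -> phi x = 0) -> test_fun phi.
Proof.
move=> dp cp sp; split; [by move=> x; case: (dp x)| |by exists M].
by rewrite (is_derive_derive1 dp).
Qed.

Lemma test_fun_is_derive phi : test_fun phi ->
  forall x, is_derive x 1 phi ((phi^`())%classic x).
Proof. by case=> dp _ _ x; rewrite derive1E; exact/derivableP/dp. Qed.

Lemma derivable_LR f f' a b : (forall x, is_derive x 1 f (f' x)) ->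
  derivable_oo_LRcontinuous f a b.
Proof.
move=> ff'; have cf := is_derive_continuous ff'; split.
- by move=> x _; case: (ff' x).
- by apply: cvg_at_right_filter; exact: cf.
- by apply: cvg_at_left_filter; exact: cf.
Qed.

Lemma eq0_derive f f' x : (forall x, is_derive x 1 f (f' x)) ->
  (\near x, f x = 0) -> f' x = 0.
Proof.
move=> ff' f0; have [_ <-] := ff' x.
rewrite (near_eq_derive _ (g := cst 0)) ?derive_cst//.
Qed.

Lemma near_lt_norm (M x : R) : M < `|x| -> \forall y \near x, M < `|y|.
Proof.
have h : `|y| @[y --> x] --> `|x| by apply: cvg_norm; exact: cvg_id.
exact: (cvgr_gt _ h).
Qed.

Lemma Rintegral_by_parts_test f f' phi : (forall x, is_derive x 1 f (f' x)) ->
  continuous f' -> test_fun phi ->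
  \int[mu]_x (f x * (phi^`())%classic x) = - \int[mu]_x (f' x * phi x).
Proof.
move=> ff' cf' tphi; have dphi := test_fun_is_derive tphi.
case: tphi => _ cphi [M Mphi].
have Mphi' x : M < `|x| -> phi^`()%classic x = 0.
  move=> Mx; apply: (eq0_derive dphi); near=> y; apply: Mphi; near: y.
  exact: near_lt_norm.
(* [M] may be negative, whereas [N] must be positive and exceed [M], so that the boundary terms at
   -N and N vanish. *)
pose N := `|M| + 1.
have N0 : 0 < N by rewrite ltr_wpDl.
have out x : x \notin `[- N, N] -> M < `|x|.
  move=> xN; rewrite (le_lt_trans (ler_norm M))// (@lt_le_trans _ _ N) ?ltrDl//.
  move: xN; apply: contraR; rewrite -ltNge => xN.
  by rewrite in_itv/= -ler_norml ltW.
have restr h : (forall x, M < `|x| -> h x = 0) ->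
    \int[mu]_x h x = \int[mu]_(x in `[- N, N]) h x.
  move=> h0; rewrite [RHS]Rintegral_mkcond; apply: eq_Rintegral => x _.
  rewrite patchE; case: ifPn => // xN; apply/h0/out.
  by apply: contra xN => xN; rewrite inE.
rewrite !restr; last 2 first.
- by move=> x /Mphi ->; rewrite mulr0.
- by move=> x /Mphi' ->; rewrite mulr0.
rewrite (@Rintegration_by_parts _ f phi f' (phi^`())%classic); last 7 first.
- by rewrite gtrN.
- exact: continuous_subspaceT.
- exact: derivable_LR ff'.
- by move=> x _; rewrite (is_derive_derive1 ff').
- exact: continuous_subspaceT.
- exact: derivable_LR dphi.
- by [].
have MN : M < N by rewrite (le_lt_trans (ler_norm M))// ltrDl.
by rewrite !Mphi ?normrN ?(gtr0_norm N0)// !mulr0 subrr sub0r.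
Unshelve. all: by end_near. Qed.

Lemma Rintegral_dominated_cvg (f_ : nat -> R -> R) f g :
  (forall n, measurable_fun setT (f_ n)) ->
  (forall x, f_ n x @[n --> \oo] --> f x) ->
  mu.-integrable setT (EFin \o g) ->
  (forall n x, `|f_ n x| <= g x) ->
  \int[mu]_x f_ n x @[n --> \oo] --> \int[mu]_x f x.
Proof.
move=> mf_ f_f ig f_g.
have h := @dominated_cvg _ _ _ mu setT measurableT
  (fun n x => (f_ n x)%:E) (EFin \o f) (EFin \o g).
apply: fine_cvg; rewrite fineK.
  apply: h => //.
  - by move=> n; apply/measurable_EFinP; exact: mf_.
  - by move=> x _ /=; apply: cvg_EFin; [exact: nearW|exact: f_f].
  - by move=> n x _; rewrite lee_fin f_g.
apply: integrable_fin_num => //; apply: (le_Rintegrable _ _ ig).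
  by apply: (measurable_fun_cvg mf_) => x _; exact: f_f.
move=> x; have cx : `|f_ n x| @[n --> \oo] --> `|f x| by exact: cvg_norm.
rewrite -(cvg_lim _ cx)//; apply: limr_le; first by apply/cvg_ex; eexists;
  exact: cx.
exact: nearW.
Qed.

End weak_derivative.

(** * The fundamental lemma of the calculus of variations *)

Section fundamental_lemma.
Context {R : realType}.
Notation mu := (@lebesgue_measure R).
Implicit Types (f g h phi dphi : R -> R) (x : R).

Lemma Lfun2_norm f : f \in Lfun mu 2%:E -> (fun x => `|f x|) \in Lfun mu 2%:E.
Proof.
move=> /Lfun2P[mf if2]; apply/Lfun2P; split; first exact: measurableT_comp.
by apply: eq_integrable if2 => // x _ /=; rewrite -normrX ger0_norm// sqr_ge0.
Qed.

Lemma Lfun2_ZoneDsqrV (K : R) : (fun x => K * (oneDsqr x)^-1) \in Lfun mu 2%:E.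
Proof.
apply: (@Lfun2_le_oneDsqrV _ _ `|K|).
  apply: continuous_measurable_fun => x; apply: cvgMl_tmp.
  exact: continuous_oneDsqrV.
by move=> x; rewrite normrM (@ger0_norm _ (oneDsqr x)^-1).
Qed.

Section bump.
Variables a b : R.

(* C^1 substitute for the indicator function of ]a, b[, to which it converges
   pointwise as e tends to 0. *)
Definition bump (e x : R) : R :=
  pospart ((x - a) * (b - x)) ^+ 2 / (pospart ((x - a) * (b - x)) ^+ 2 + e).

Lemma bump_ge0 e x : 0 < e -> 0 <= bump e x.
Proof.
by move=> e0; rewrite divr_ge0 ?sqr_ge0// addr_ge0 ?sqr_ge0 ?ltW.
Qed.

Lemma bump_le1 e x : 0 < e -> bump e x <= 1.
Proof.
by move=> e0; rewrite ler_pdivrMr ?ltr_wpDl ?sqr_ge0// mul1r lerDl ltW.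
Qed.

Lemma bump_out e x : ~~ (a < x < b) -> a < b -> bump e x = 0.
Proof.
rewrite negb_and -!leNgt => h ab.
rewrite /bump le0_pospart ?expr0n ?mul0r//.
by case/orP : h => h; nra.
Qed.

Lemma bump_test_fun e : 0 < e -> a < b -> test_fun (bump e).
Proof.
move=> e0 ab.
pose c x : R := (x - a) * (b - x).
have dc x : is_derive x 1 c (a + b - 2 * x).
  apply: is_derive_eq (is_derive_mulf
    (is_derive_subf (is_derive_idf x) (is_derive_cstf a x))
    (is_derive_subf (is_derive_cstf b x) (is_derive_idf x))) _.
  by ring.
pose B x := pospart (c x) ^+ 2.
have B0 x : B x + e != 0 by rewrite gt_eqF// ltr_wpDl ?sqr_ge0.
pose B' x := 2 * pospart (c x) * (a + b - 2 * x).
have dB x : is_derive x 1 B (B' x).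
  exact: (@is_derive_compf _ (fun y => pospart y ^+ 2)) (is_derive_pospart2 _)
    (dc x).
have cB := is_derive_continuous dB; have cc := is_derive_continuous dc.
apply: (@test_funP _ _ (fun x => B' x * (B x + e)^-1 + B x * (- B' x / (B x +
  e) ^+ 2)) (`|a| + `|b|)).
- move=> x; have dBe := is_derive_addf (dB x) (is_derive_cstf e x).
  have dV := @is_derive_invf _ (fun y => B y + e) x _ (B0 x) dBe.
  apply: is_derive_eq (is_derive_mulf (dB x) dV) _.
  by rewrite addr0.
- have cB' : continuous B'.
    move=> x; apply: cvgM.
      apply: cvgMl_tmp; apply: (@continuous_comp _ _ _ c pospart);
        first exact: cc.
      exact: continuous_pospart.
    apply: cvgB; first exact: cvg_cst.
    by apply: cvgMl_tmp; exact: cvg_id.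
  move=> x; have cBe : B y + e @[y --> x] --> B x + e.
    by apply: cvgD; [exact: cB|exact: cvg_cst].
  apply: cvgD; apply: cvgM => //; [exact: cB'|exact: cvgV|exact: cB|].
  apply: cvgM; first by apply: cvgN; exact: cB'.
  by apply: cvgV; [rewrite expf_neq0|exact: (cvgM cBe cBe)].
- move=> x abx; apply: bump_out => //; apply/negP => /andP[ax xb].
  move: abx; apply/negP; rewrite -leNgt ler_norml.
  have := (ler_norm a, ler_norm b, ler_norm (- a), ler_norm (- b)).
  by rewrite !normrN => -[[[? ?] ?] ?]; apply/andP; split; lra.
Qed.

Lemma cvg_bump x : a < x < b -> bump (harmonic n) x @[n --> \oo] --> (1 : R).
Proof.
move=> /andP[ax xb]; pose B := pospart ((x - a) * (b - x)) ^+ 2.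
have B0 : B != 0.
  by rewrite expf_neq0// gt_eqF// ge0_pospart ?mulr_gt0 ?subr_gt0// ltW
    ?mulr_gt0 ?subr_gt0.
rewrite (_ : 1 = B * (B + 0)^-1); last by rewrite addr0 divff.
apply: cvgMl_tmp; apply: cvgV; first by rewrite addr0.
by apply: cvgD; [exact: cvg_cst|exact: cvg_harmonic].
Qed.

End bump.

(** A multiple of the weight dominates the indicator of [a, b]. As the weight is in L2, its product
    with an L2 function is an integrable majorant on the interval. *)
Lemma sqr_le_oneDsqr a b x : a <= x <= b ->
  1 <= (1 + (a ^+ 2 + b ^+ 2)) * (oneDsqr x)^-1.
Proof.
move=> /andP[ax xb]; have ox : 0 < oneDsqr x by rewrite (lt_le_trans ltr01).
rewrite ler_pdivlMr// mul1r /oneDsqr lerD2l.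
by have [x0|x0] := lerP 0 x; nra.
Qed.

Lemma Lfun2_integrable_itv f a b : f \in Lfun mu 2%:E ->
  mu.-integrable `[a, b] (EFin \o f).
Proof.
move=> f2.
have ig := integrable_mul (Lfun2_norm f2)
  (Lfun2_ZoneDsqrV (1 + (a ^+ 2 + b ^+ 2))).
have {}ig : mu.-integrable `[a, b]
    (EFin \o (fun x => `|f x| * ((1 + (a ^+ 2 + b ^+ 2)) / oneDsqr x))).
  exact: integrableS ig.
apply: (le_integrable _ _ _ ig) => //.
  by apply/measurable_EFinP/measurable_funTS; exact: Lfun2_meas.
move=> x /=; rewrite in_itv/= lee_fin => xab.
rewrite normrM normr_id ler_peMr// (le_trans (sqr_le_oneDsqr xab))//.
exact: ler_norm.
Qed.

Lemma Rintegral_itv_eq0 f a b : f \in Lfun mu 2%:E ->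
  (forall phi, test_fun phi -> \int[mu]_x (f x * phi x) = 0) -> a < b ->
  \int[mu]_(x in `]a, b]) f x = 0.
Proof.
move=> f2 f0 ab; have mf := Lfun2_meas f2.
(* The bumps vanish at b, so their limit is the indicator of the open interval; the endpoint has
   measure zero. *)
rewrite -Rintegral_itv_bndo_bndc; last first.
  apply: integrableS (Lfun2_integrable_itv a b f2) => //.
  exact: subset_itvW.
pose K := 1 + (a ^+ 2 + b ^+ 2).
have : \int[mu]_x (f x * bump a b (harmonic n) x) @[n --> \oo] --> \int[mu]_x
  (f \_ `]a, b[) x.
  apply: (@Rintegral_dominated_cvg _ _ _ (fun x => `|f x| * (K * (oneDsqr
    x)^-1))).
  - move=> n; apply: measurable_funM => //; apply: continuous_measurable_fun.
    have := @bump_test_fun a b (harmonic n) (harmonic_gt0 n) ab =>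
      /test_fun_is_derive.
    exact: is_derive_continuous.
  - move=> x; rewrite patchE; case: ifPn => [|xab].
      rewrite inE/= in_itv/= => xab; rewrite -[X in _ --> X]mulr1.
      by apply: cvgMl_tmp; exact: cvg_bump.
    have -> : (fun n => f x * bump a b (harmonic n) x) = (fun=> 0).
      apply/funext => n; rewrite bump_out ?mulr0//.
      by apply: contra xab => h; rewrite inE/= in_itv.
    exact: cvg_cst.
  - apply: integrable_mul; [exact: Lfun2_norm|exact: Lfun2_ZoneDsqrV].
  - move=> n x; rewrite normrM ler_wpM2l// ger0_norm ?bump_ge0 ?harmonic_gt0//.
    have [xab|xab] := boolP (a < x < b); last first.
      by rewrite bump_out// mulr_ge0// addr_ge0// addr_ge0 ?sqr_ge0.
    apply: le_trans (bump_le1 _ _ _ (harmonic_gt0 n)) _.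
    by apply: sqr_le_oneDsqr; case/andP: xab => /ltW-> /ltW->.
have -> : (fun n => \int[mu]_x (f x * bump a b (harmonic n) x)) = (fun=> 0).
  by apply/funext => n; rewrite f0//; apply: bump_test_fun => //;
    exact: harmonic_gt0.
move=> h; rewrite [LHS]Rintegral_mkcond.
exact: (cvg_unique _ h (@cvg_cst _ _ _ _ _)).
Qed.

(* The bumps show that f has zero integral over every interval; the Lebesgue
   differentiation theorem concludes. *)
Lemma weak_eq0 f : f \in Lfun mu 2%:E ->
  (forall phi, test_fun phi -> \int[mu]_x (f x * phi x) = 0) ->
  {ae mu, forall x, f x = 0}.
Proof.
move=> f2 f0; have mf := Lfun2_meas f2.
have floc : locally_integrable setT f.
  split => //; first exact: openT.
  move=> K _ cK; have [M [_ MK]] := compact_bounded cK.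
  have KM : K `<=` `[- (M + 1), M + 1].
    have M1 : M < M + 1 by rewrite ltrDl.
    by move=> x /(MK _ M1) /=; rewrite in_itv/= ler_norml.
  have /integrableP[_] : mu.-integrable K (EFin \o f).
    apply: integrableS (Lfun2_integrable_itv (- (M + 1)) (M + 1) f2) => //.
    exact: compact_measurable.
  by [].
(* A primitive needs a fixed left end, so the line is exhausted by the half-lines that start at
   -N. *)
have step (N : nat) : {ae mu, forall x, - N%:R < x -> f x = 0}.
  pose F (x : R) := \int[mu]_(t in `]- N%:R, x]) f t.
  have F0 : F = fun=> 0.
    apply/funext => x; rewrite /F; have [Nx|xN] := ltP (- N%:R) x.
      exact: Rintegral_itv_eq0.
    by rewrite set_itv_ge ?Rintegral_set0// bnd_simp -leNgt.
  have h y : mu.-integrable [set` Interval (BRight (- N%:R)) (BRight y)] (EFin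
    \o f).
    apply: integrableS (Lfun2_integrable_itv (- N%:R) y f2) => //.
    by apply: subset_itvr; rewrite bnd_simp.
  have := @FTC1 R f (BRight (- N%:R)) h floc.
  apply: filterS; first exact: (ae_filter_ringOfSetsType mu).
  move=> x h1 Nx; have [_ <-] := h1 Nx.
  by rewrite -/F F0 derive1E derive_cst.
have : {ae mu, forall x, forall n : nat, - n%:R < x -> f x = 0}.
  exact: ae_foralln.
apply: filterS; first exact: (ae_filter_ringOfSetsType mu).
move=> x h.
have [N xN] : exists N : nat, - N%:R < x.
  exists (Num.bound `|x|); rewrite ltrNl.
  by rewrite (le_lt_trans (ler_norm _))// normrN archi_boundP.
exact: (h N).
Qed.

End fundamental_lemma.

(** * Integration by parts on the whole line *)

Section cutoff.
Context {R : realType}.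
Notation mu := (@lebesgue_measure R).
Implicit Types (f g h phi dphi : R -> R) (x e : R).

(** A C^1 function with value 1 at 0 and support in [-1/e, 1/e], which tends to 1 pointwise as e
    tends to 0, with slope of order e. *)
Definition cutoff e x : R := pospart (1 - (e * x) ^+ 2) ^+ 2.
Definition dcutoff e x : R :=
  2 * pospart (1 - (e * x) ^+ 2) * (- (2 * e ^+ 2 * x)).

Lemma pospart_le1 e x : pospart (1 - (e * x) ^+ 2) <= 1.
Proof.
have := sqr_ge0 (e * x); have [c0|/ltW c0] := leP 0 (1 - (e * x) ^+ 2).
  by rewrite ge0_pospart// lerBlDr lerDl.
by rewrite le0_pospart.
Qed.

Lemma cutoff_ge0 e x : 0 <= cutoff e x.
Proof. exact: sqr_ge0. Qed.

Lemma cutoff_le1 e x : cutoff e x <= 1.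
Proof. by rewrite /cutoff expr_le1// ?pospart_ge0// pospart_le1. Qed.

Lemma is_derive_cutoff e x : is_derive x 1 (cutoff e) (dcutoff e x).
Proof.
pose c x : R := 1 - (e * x) * (e * x).
have dl : is_derive x 1 (fun y => e * y) (0 * x + e * 1).
  exact: is_derive_mulf (is_derive_cstf e x) (is_derive_idf x).
have dc : is_derive x 1 c (- (2 * e ^+ 2 * x)).
  apply: is_derive_eq (is_derive_subf (is_derive_cstf 1 x) (is_derive_mulf dl
    dl)) _.
  by ring.
exact: (@is_derive_compf _ (fun y => pospart y ^+ 2)) (is_derive_pospart2 _) dc.
Qed.

Lemma continuous_dcutoff e : continuous (dcutoff e).
Proof.
move=> x; have ce : e * y @[y --> x] --> e * x by apply: cvgMl_tmp;
  exact: cvg_id.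
apply: cvgM.
  apply: cvgMl_tmp.
  have := @continuous_comp _ _ _ (fun y => 1 - (e * y) * (e * y)) pospart x.
  apply; last exact: continuous_pospart.
  by apply: cvgB; [exact: cvg_cst|exact: cvgM].
by apply: cvgN; apply: cvgMl_tmp; exact: cvg_id.
Qed.

(** The slope is - 4 e times [pospart] times e x, and |e x| <= 1 wherever [pospart] is not zero. *)
Lemma norm_dcutoff e x : 0 <= e -> `|dcutoff e x| <= 4 * e.
Proof.
move=> e0; rewrite (_ : dcutoff e x = - (4 * e) * (pospart (1 - (e * x) ^+ 2) *
  (e * x)));
  last by rewrite /dcutoff; ring.
have e4 : 0 <= 4 * e by rewrite mulr_ge0.
rewrite normrM normrN (ger0_norm e4) ler_piMr//.
rewrite normrM ger0_norm ?pospart_ge0//.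
have [c0|/ltW c0] := leP 0 (1 - (e * x) ^+ 2);
  last by rewrite le0_pospart// mul0r.
rewrite mulr_ile1 ?pospart_ge0 ?pospart_le1//.
by move: c0; rewrite subr_ge0 -real_normK ?num_real// expr_le1.
Qed.

Lemma cutoff_out e x : 0 < e -> e^-1 < `|x| -> cutoff e x = 0.
Proof.
move=> e0 ex; rewrite /cutoff le0_pospart ?expr0n// subr_le0.
rewrite -real_normK ?num_real// expr_ge1// normrM (ger0_norm (ltW e0)).
by rewrite -ler_pdivrMl// mulr1 ltW.
Qed.

Lemma cvg_cutoff x : cutoff (harmonic n) x @[n --> \oo] --> (1 : R).
Proof.
have hx : harmonic n * x @[n --> \oo] --> (0 : R).
  by rewrite -[X in _ --> X](mul0r x); exact: (cvgMr_tmp (@cvg_harmonic R)).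
have c1 : pospart (1 - (harmonic n * x) ^+ 2) @[n --> \oo] --> pospart (1 - 0 *
  0 : R).
  have h : 1 - (harmonic n * x) ^+ 2 @[n --> \oo] --> (1 - 0 * 0 : R).
    by apply: cvgB; [exact: cvg_cst|exact: (cvgM hx hx)].
  exact: (cvg_comp _ _ h (@continuous_pospart R _)).
rewrite mul0r subr0 ge0_pospart// in c1.
by rewrite -[X in _ --> X](mulr1 1); exact: (cvgM c1 c1).
Qed.

Lemma cvg_dcutoff x : dcutoff (harmonic n) x @[n --> \oo] --> (0 : R).
Proof.
apply/cvgr0Pnorm_le => eps eps0; near=> n.
apply: le_trans (norm_dcutoff _ (ltW (harmonic_gt0 n))) _.
rewrite -ler_pdivlMl//; near: n.
have h := @cvg_harmonic R.
have : 0 < 4^-1 * eps by rewrite mulr_gt0.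
by move=> h4; exact: (cvgr_le _ h _ h4).
Unshelve. all: by end_near. Qed.

(* f is not compactly supported: the weak derivative is tested against the
   product of f with cutoffs that tend to 1. *)
Lemma weak_derivative_by_parts f f' g dg :
  (forall x, is_derive x 1 f (f' x)) -> continuous f' ->
  f \in Lfun mu 2%:E -> f' \in Lfun mu 2%:E ->
  g \in Lfun mu 2%:E -> dg \in Lfun mu 2%:E ->
  (forall phi, test_fun phi ->
    \int[mu]_x (g x * (phi^`())%classic x) = - \int[mu]_x (dg x * phi x)) ->
  \int[mu]_x (g x * f' x) = - \int[mu]_x (dg x * f x).
Proof.
move=> ff' cf' f2 f'2 g2 dg2 weak; have cf := is_derive_continuous ff'.
pose phi n x := f x * cutoff (harmonic n) x.
pose dphi n x := f' x * cutoff (harmonic n) x + f x * dcutoff (harmonic n) x.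
have dphiE n x : is_derive x 1 (phi n) (dphi n x).
  exact: is_derive_mulf (ff' x) (is_derive_cutoff _ x).
have ccut n : continuous (cutoff (harmonic n)) := is_derive_continuous
  (is_derive_cutoff _).
have cdphi n : continuous (dphi n).
  move=> x; apply: cvgD; apply: cvgM;
    [exact: cf'|exact: ccut|exact: cf|exact: continuous_dcutoff].
have tphi n : test_fun (phi n).
  apply: (@test_funP _ _ _ (harmonic n)^-1 (dphiE n) (cdphi n)) => x ex.
  by rewrite /phi cutoff_out ?mulr0// harmonic_gt0.
have w n : \int[mu]_x (g x * dphi n x) = - \int[mu]_x (dg x * phi n x).
  by rewrite -weak// (is_derive_derive1 (dphiE n)).
have cut1 n x : `|cutoff (harmonic n) x| <= 1.
  by rewrite ger0_norm ?cutoff_ge0// cutoff_le1.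
have l1 : \int[mu]_x (g x * dphi n x) @[n --> \oo] --> \int[mu]_x (g x * f' x).
  (* The cutoffs are at most 1 and their slopes at most 4, because [harmonic n] <= 1. *)
  apply: (@Rintegral_dominated_cvg _ _ _ (fun x => `|g x| * (`|f' x| + 4 * `|f
    x|))).
  - move=> n; apply: measurable_funM; first exact: Lfun2_meas.
    exact: continuous_measurable_fun.
  - move=> x; apply: cvgMl_tmp; rewrite -[X in _ --> X]addr0; apply: cvgD.
      by rewrite -[X in _ --> X]mulr1; apply: cvgMl_tmp; exact: cvg_cutoff.
    by rewrite -(mulr0 (f x)); apply: cvgMl_tmp; exact: cvg_dcutoff.
  - apply: integrable_mul; first exact: Lfun2_norm.
    by apply: Lfun2D; [exact: Lfun2_norm|apply: Lfun2Z; exact: Lfun2_norm].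
  - move=> n x; rewrite normrM ler_wpM2l// (le_trans (ler_normD _ _))// (normrM
    (f' x)) (normrM (f x)) lerD//.
      by rewrite ler_piMr ?cut1.
    rewrite mulrC ler_wpM2r// (le_trans (norm_dcutoff _ (ltW (harmonic_gt0
      n))))//.
    by rewrite ler_piMr// invf_le1 ?ler1n.
have l2 : \int[mu]_x (dg x * phi n x) @[n --> \oo] --> \int[mu]_x (dg x * f x).
  apply: (@Rintegral_dominated_cvg _ _ _ (fun x => `|dg x| * `|f x|)).
  - move=> n; apply: measurable_funM; first exact: Lfun2_meas.
    apply: continuous_measurable_fun; exact: is_derive_continuous (dphiE n).
  - move=> x; apply: cvgMl_tmp.
    by rewrite -[X in _ --> X]mulr1; apply: cvgMl_tmp; exact: cvg_cutoff.
  - by apply: integrable_mul; exact: Lfun2_norm.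
  - by move=> n x; rewrite normrM ler_wpM2l// normrM ler_piMr ?cut1.
apply: (cvg_unique _ l1) => //.
have -> : (fun n => \int[mu]_x (g x * dphi n x)) = (fun n => - \int[mu]_x (dg x
  * phi n x)).
  exact/funext.
exact: cvgN.
Qed.

End cutoff.

(** * Complex-valued functions *)

Section complex_calculus.
Context {R : realType}.
Implicit Types (f g h : R -> R[i]) (z w : R[i]).

Local Notation Re := (@complex.Re R).
Local Notation Im := (@complex.Im R).

Lemma ReD z w : Re (z + w) = Re z + Re w. Proof. by case: z; case: w. Qed.
Lemma ImD z w : Im (z + w) = Im z + Im w. Proof. by case: z; case: w. Qed.
Lemma ReN z : Re (- z) = - Re z. Proof. by case: z. Qed.
Lemma ImN z : Im (- z) = - Im z. Proof. by case: z. Qed.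
Lemma ReM z w : Re (z * w) = Re z * Re w - Im z * Im w.
Proof. by case: z; case: w. Qed.
Lemma ImM z w : Im (z * w) = Re z * Im w + Im z * Re w.
Proof. by case: z; case: w. Qed.
Lemma ReV z : Re z^-1 = Re z / (Re z ^+ 2 + Im z ^+ 2).
Proof. by case: z. Qed.
Lemma ImV z : Im z^-1 = - Im z / (Re z ^+ 2 + Im z ^+ 2).
Proof. by case: z => a b; rewrite mulNr. Qed.

Lemma sqr_normc_eq0 z : (Re z ^+ 2 + Im z ^+ 2 == 0) = (z == 0).
Proof. by rewrite paddr_eq0 ?sqr_ge0// !sqrf_eq0 eq_complex. Qed.

Lemma complex_eq z w : Re z = Re w -> Im z = Im w -> z = w.
Proof. by case: z w => ? ? [? ?] /= -> ->. Qed.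

Lemma normc_real (x : R) : Normc.normc (real_complex R x) = `|x|.
Proof. by rewrite /= expr0n addr0 sqrtr_sqr. Qed.

Lemma normRe_le z : `|Re z| <= Normc.normc z.
Proof. by rewrite -sqrtr_sqr; case: z => a b /=;
  rewrite ler_wsqrtr// lerDl sqr_ge0. Qed.

Lemma normIm_le z : `|Im z| <= Normc.normc z.
Proof. by rewrite -sqrtr_sqr; case: z => a b /=;
  rewrite ler_wsqrtr// lerDr sqr_ge0. Qed.

Lemma normc_le_ReIm z : Normc.normc z <= `|Re z| + `|Im z|.
Proof.
rewrite -(ler_pXn2r (n:=2)) ?nnegrE ?normc_ge0 ?addr_ge0//.
rewrite sqr_Normc sqrrD !real_normK ?num_real// lerD2r lerDl mulrn_wge0//.
Qed.

Definition is_cderive f f' := forall x : R,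
  is_derive x 1 (fun y => Re (f y)) (Re (f' x)) /\
  is_derive x 1 (fun y => Im (f y)) (Im (f' x)).

Definition ccontinuous f :=
  continuous (fun y => Re (f y)) /\ continuous (fun y => Im (f y)).

Lemma is_cderive_continuous f f' : is_cderive f f' -> ccontinuous f.
Proof.
move=> ff'; split.
- exact: (is_derive_continuous (fun x => (ff' x).1)).
- exact: (is_derive_continuous (fun x => (ff' x).2)).
Qed.

Lemma is_cderive_cst z : is_cderive (fun=> z) (fun=> 0).
Proof. by move=> x; split; exact: is_derive_cst. Qed.

Lemma is_cderiveD f f' g g' : is_cderive f f' -> is_cderive g g' ->
  is_cderive (fun x => f x + g x) (fun x => f' x + g' x).
Proof.
move=> ff' gg' x; have [f1 f2] := ff' x; have [g1 g2] := gg' x; split.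
- under eq_fun do rewrite ReD; rewrite ReD; exact: is_derive_addf.
- under eq_fun do rewrite ImD; rewrite ImD; exact: is_derive_addf.
Qed.

Lemma is_cderiveM f f' g g' : is_cderive f f' -> is_cderive g g' ->
  is_cderive (fun x => f x * g x) (fun x => f' x * g x + f x * g' x).
Proof.
move=> ff' gg' x; have [f1 f2] := ff' x; have [g1 g2] := gg' x; split.
- under eq_fun do rewrite ReM; rewrite ReD !ReM.
  apply: is_derive_eq (is_derive_subf (is_derive_mulf f1 g1) (is_derive_mulf f2
    g2)) _.
  ring.
- under eq_fun do rewrite ImM; rewrite ImD !ImM.
  apply: is_derive_eq (is_derive_addf (is_derive_mulf f1 g2) (is_derive_mulf f2
    g1)) _.
  ring.
Qed.

Lemma is_cderiveZ z f f' : is_cderive f f' ->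
  is_cderive (fun x => z * f x) (fun x => z * f' x).
Proof.
move=> ff' x; have := is_cderiveM (is_cderive_cst z) ff' x.
by rewrite mul0r add0r.
Qed.

Lemma is_cderiveV f f' : (forall x, f x != 0) -> is_cderive f f' ->
  is_cderive (fun x => (f x)^-1) (fun x => - f' x / f x ^+ 2).
Proof.
move=> f0 ff' x; have [f1 f2] := ff' x.
have N0 : Re (f x) ^+ 2 + Im (f x) ^+ 2 != 0 by rewrite sqr_normc_eq0.
have dN := is_derive_addf (is_derive_mulf f1 f1) (is_derive_mulf f2 f2).
have dNV := @is_derive_invf _ _ x _ N0 dN.
have N20 : (Re (f x) * Re (f x) - Im (f x) * Im (f x)) ^+ 2 +
    (Re (f x) * Im (f x) + Im (f x) * Re (f x)) ^+ 2 != 0.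
  rewrite (_ : _ + _ = (Re (f x) ^+ 2 + Im (f x) ^+ 2) ^+ 2); last by ring.
  by rewrite expf_neq0.
split.
- under eq_fun do rewrite ReV; rewrite ReM ReV ImV !ReN !ImN !expr2 !ReM !ImM.
  apply: is_derive_eq (is_derive_mulf f1 dNV) _.
  by move: N20 N0; rewrite !expr2 => N20 N0; field; rewrite N20 N0.
- under eq_fun do rewrite ImV; rewrite ImM ReV ImV !ReN !ImN !expr2 !ReM !ImM.
  apply: is_derive_eq (is_derive_mulf (is_derive_oppf f2) dNV) _.
  by move: N20 N0; rewrite !expr2 => N20 N0; field; rewrite N20 N0.
Qed.

Lemma ccontinuousD f g : ccontinuous f -> ccontinuous g ->
  ccontinuous (fun x => f x + g x).
Proof.
move=> [f1 f2] [g1 g2]; split=> x.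
- by under eq_fun do rewrite ReD; apply: cvgD; [exact: f1|exact: g1].
- by under eq_fun do rewrite ImD; apply: cvgD; [exact: f2|exact: g2].
Qed.

Lemma ccontinuousM f g : ccontinuous f -> ccontinuous g ->
  ccontinuous (fun x => f x * g x).
Proof.
move=> [f1 f2] [g1 g2]; split=> x.
- under eq_fun do rewrite ReM; apply: cvgB; apply: cvgM;
    [exact: f1|exact: g1|exact: f2|exact: g2].
- under eq_fun do rewrite ImM; apply: cvgD; apply: cvgM;
    [exact: f1|exact: g2|exact: f2|exact: g1].
Qed.

Lemma ccontinuous_measurable f : ccontinuous f ->
  measurable_fun setT (fun x => Re (f x)) /\
  measurable_fun setT (fun x => Im (f x)).
Proof. by case=> f1 f2; split; exact: continuous_measurable_fun. Qed.

End complex_calculus.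

(** * Complex integrals, uniqueness of weak derivatives, C^1 functions in H^1 *)

Section complex_integral.
Context {R : realType}.
Notation mu := (@lebesgue_measure R).
Implicit Types (f g h : R -> R[i]) (z w : R[i]).

Local Notation Re := (@complex.Re R).
Local Notation Im := (@complex.Im R).

Definition cintegrable f := mu.-integrable setT (EFin \o (fun x => Re (f x))) /\
  mu.-integrable setT (EFin \o (fun x => Im (f x))).

Lemma integrable_addf (f g : R -> R) : mu.-integrable setT (EFin \o f) ->
  mu.-integrable setT (EFin \o g) ->
  mu.-integrable setT (EFin \o (fun x => f x + g x)).
Proof.
move=> fi gi; have := integrableD measurableT fi gi.
by apply: eq_integrable => // x _ /=; rewrite EFinD.
Qed.

Lemma integrable_subf (f g : R -> R) : mu.-integrable setT (EFin \o f) ->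
  mu.-integrable setT (EFin \o g) ->
  mu.-integrable setT (EFin \o (fun x => f x - g x)).
Proof.
move=> fi gi; have := integrableB measurableT fi gi.
by apply: eq_integrable => // x _ /=; rewrite EFinB.
Qed.

Lemma integrable_mulf (k : R) (f : R -> R) : mu.-integrable setT (EFin \o f) ->
  mu.-integrable setT (EFin \o (fun x => k * f x)).
Proof.
move=> fi; have := @integrableZl _ _ _ mu _ measurableT k _ fi.
by apply: eq_integrable => // x _ /=; rewrite EFinM.
Qed.

Lemma cintegralD f g : cintegrable f -> cintegrable g ->
  cintegral (fun x => f x + g x) = cintegral f + cintegral g.
Proof.
move=> [f1 f2] [g1 g2]; apply: complex_eq; rewrite ?ReD ?ImD /=.
- by under eq_Rintegral do rewrite ReD; rewrite RintegralD.
- by under eq_Rintegral do rewrite ImD; rewrite RintegralD.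
Qed.

Lemma cintegrableD f g : cintegrable f -> cintegrable g ->
  cintegrable (fun x => f x + g x).
Proof.
move=> [f1 f2] [g1 g2]; split.
- by under eq_fun do rewrite ReD; exact: integrable_addf.
- by under eq_fun do rewrite ImD; exact: integrable_addf.
Qed.

Lemma cintegralZ z f : cintegrable f ->
  cintegral (fun x => z * f x) = z * cintegral f.
Proof.
move=> [f1 f2]; apply: complex_eq; rewrite ?ReM ?ImM /=.
- under eq_Rintegral do rewrite ReM.
  by rewrite RintegralB ?RintegralZl//; exact: integrable_mulf.
- under eq_Rintegral do rewrite ImM.
  by rewrite RintegralD ?RintegralZl//; exact: integrable_mulf.
Qed.

Lemma cintegrableZ z f : cintegrable f -> cintegrable (fun x => z * f x).
Proof.
move=> [f1 f2]; split.
- under eq_fun do rewrite ReM.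
  by apply: integrable_subf; exact: integrable_mulf.
- under eq_fun do rewrite ImM.
  by apply: integrable_addf; exact: integrable_mulf.
Qed.

Lemma L2_cintegrable f g : L2 f -> L2 g -> cintegrable (fun x => f x * g x).
Proof.
move=> [f1 f2] [g1 g2]; split.
- under eq_fun do rewrite ReM.
  by apply: integrable_subf; exact: integrable_mul.
- under eq_fun do rewrite ImM.
  by apply: integrable_addf; exact: integrable_mul.
Qed.

Lemma L2D f g : L2 f -> L2 g -> L2 (fun x => f x + g x).
Proof.
move=> [f1 f2] [g1 g2]; split.
- by under eq_fun do rewrite ReD; exact: Lfun2D.
- by under eq_fun do rewrite ImD; exact: Lfun2D.
Qed.

Lemma L2N f : L2 f -> L2 (fun x => - f x).
Proof.
move=> [f1 f2]; split.
- by under eq_fun do rewrite ReN; exact: Lfun2N.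
- by under eq_fun do rewrite ImN; exact: Lfun2N.
Qed.

Lemma L2Z z f : L2 f -> L2 (fun x => z * f x).
Proof.
move=> [f1 f2]; split.
- by under eq_fun do rewrite ReM; apply: Lfun2B; exact: Lfun2Z.
- by under eq_fun do rewrite ImM; apply: Lfun2D; exact: Lfun2Z.
Qed.

Lemma L2B f g : L2 f -> L2 g -> L2 (f \- g).
Proof. by move=> f2 g2; apply: L2D => //; exact: L2N. Qed.

Definition cmeasurable f := measurable_fun setT (fun x => Re (f x)) /\
  measurable_fun setT (fun x => Im (f x)).

Lemma L2_cmeasurable f : L2 f -> cmeasurable f.
Proof. by case=> f1 f2; split; exact: Lfun2_meas. Qed.

Lemma ae_eq_Rintegral (f g : R -> R) : measurable_fun setT f ->
  measurable_fun setT g -> {ae mu, forall x, f x = g x} ->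
  \int[mu]_x f x = \int[mu]_x g x.
Proof.
move=> mf mg fg; congr fine; apply: ae_eq_integral => //.
- exact/measurable_EFinP.
- exact/measurable_EFinP.
- apply: filterS fg; first exact: (ae_filter_ringOfSetsType mu).
  by move=> x -> _.
Qed.

Lemma ae_eq_cintegral f g : cmeasurable f -> cmeasurable g ->
  {ae mu, forall x, f x = g x} -> cintegral f = cintegral g.
Proof.
move=> [f1 f2] [g1 g2] fg; apply: complex_eq => /=;
  apply: ae_eq_Rintegral => //;
  (apply: filterS fg; first exact: (ae_filter_ringOfSetsType mu));
    by move=> x ->.
Qed.

Lemma ae_eq_L2norm f g : L2 f -> L2 g -> {ae mu, forall x, f x = g x} ->
  L2norm f = L2norm g.
Proof.
move=> f2 g2 fg; apply/eqP; rewrite -(@eqrXn2 _ 2) ?L2norm_ge0//; apply/eqP.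
rewrite !sqr_L2norm//; apply: ae_eq_Rintegral.
- by apply/measurable_EFinP; exact: measurable_int (integrable_cabs2 f2).
- by apply/measurable_EFinP; exact: measurable_int (integrable_cabs2 g2).
- apply: filterS fg; first exact: (ae_filter_ringOfSetsType mu).
  by move=> x fgx; rewrite /cabs2 fgx.
Qed.

Lemma test_fun_Lfun2 (phi : R -> R) : test_fun phi -> phi \in Lfun mu 2%:E.
Proof.
move=> tphi; have cphi := is_derive_continuous (test_fun_is_derive tphi).
case: tphi => _ _ [M Mphi].
have mphi : measurable_fun setT phi by exact: continuous_measurable_fun.
apply/Lfun2P; split => //.
have : mu.-integrable `[- M, M] (EFin \o (fun x => phi x ^+ 2)).
  apply: continuous_compact_integrable; first exact: segment_compact.
  by apply: continuous_subspaceT => x; exact: (cvgM (cphi x) (cphi x)).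
rewrite integrable_mkcond//=; apply: eq_integrable => // x _.
rewrite patchE; case: ifPn => //; rewrite /= notin_setE/= in_itv/= => /negP.
by rewrite -ler_norml -ltNge => /Mphi ->; rewrite expr0n.
Qed.

Definition is_weak_derivativeR (f g : R -> R) := forall phi : R -> R,
  test_fun phi ->
  \int[mu]_x (f x * (phi^`())%classic x) = - \int[mu]_x (g x * phi x).

(** Test functions are real, so the complex relation decouples into real and imaginary parts. *)
Lemma is_weak_derivativeP f g : is_weak_derivative f g <->
  is_weak_derivativeR (fun x => Re (f x)) (fun x => Re (g x)) /\
  is_weak_derivativeR (fun x => Im (f x)) (fun x => Im (g x)).
Proof.
have ReE h (p : R -> R) : Re (cintegral (fun x => h x * real_complex R (p x))) =
    \int[mu]_x (Re (h x) * p x).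
  by rewrite /=; apply: eq_Rintegral => x _; rewrite ReM mulr0 subr0.
have ImE h (p : R -> R) : Im (cintegral (fun x => h x * real_complex R (p x))) =
    \int[mu]_x (Im (h x) * p x).
  by rewrite /=; apply: eq_Rintegral => x _; rewrite ImM mulr0 add0r.
split=> [w|[w1 w2] phi tphi].
  by split=> phi tphi; rewrite -?ReE -?ImE w// ?ReN ?ImN.
by apply: complex_eq; rewrite ?ReN ?ImN ?ReE ?ImE; [exact: w1|exact: w2].
Qed.

(** The difference of two weak derivatives integrates to zero against every test function, and
    [weak_eq0] applies. *)
Lemma is_weak_derivativeR_unique (f g1 g2 : R -> R) :
  g1 \in Lfun mu 2%:E -> g2 \in Lfun mu 2%:E ->
  is_weak_derivativeR f g1 -> is_weak_derivativeR f g2 ->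
  {ae mu, forall x, g1 x = g2 x}.
Proof.
move=> g12 g22 w1 w2.
have : {ae mu, forall x, g1 x - g2 x = 0}.
  apply: weak_eq0; first exact: Lfun2B.
  move=> phi tphi; have phi2 := test_fun_Lfun2 tphi.
  under eq_Rintegral do rewrite mulrBl.
  rewrite RintegralB//; [|exact: integrable_mul..].
  by apply/eqP; rewrite -eqr_opp opprB oppr0 addrC -(w1 _ tphi) -[X in _ +
    X]opprK -(w2 _ tphi) subrr.
apply: filterS; first exact: (ae_filter_ringOfSetsType mu).
by move=> x /eqP; rewrite subr_eq0 => /eqP.
Qed.

Lemma is_weak_derivative_unique f g1 g2 : L2 g1 -> L2 g2 ->
  is_weak_derivative f g1 -> is_weak_derivative f g2 ->
  {ae mu, forall x, g1 x = g2 x}.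
Proof.
move=> [? ?] [? ?] /is_weak_derivativeP[u1 v1] /is_weak_derivativeP[u2 v2].
have e1 : {ae mu, forall x, Re (g1 x) = Re (g2 x)} by exact:
  is_weak_derivativeR_unique u1 u2.
have e2 : {ae mu, forall x, Im (g1 x) = Im (g2 x)} by exact:
  is_weak_derivativeR_unique v1 v2.
apply: filterS2 e1 e2; first exact: (ae_filter_ringOfSetsType mu).
by move=> x; exact: complex_eq.
Qed.

Lemma wderivP f : H1 f -> L2 (wderiv f) /\ is_weak_derivative f (wderiv f).
Proof.
case=> _ [g gf].
exact: (@xgetPex _ (fun=> 0) [set g | L2 g /\ is_weak_derivative f g]
  (ex_intro _ g gf)).
Qed.

(** The explicit solution and its x-derivative lie in this class, where the weak derivative is the
    classical one and the H^1 norm can be computed from it. *)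
Record H1C1 f f' : Prop := MkH1C1 {
  H1C1_derive : is_cderive f f' ;
  H1C1_continuous : ccontinuous f' ;
  H1C1_L2 : L2 f ;
  H1C1_L2' : L2 f' }.

Lemma H1C1_weak f f' : H1C1 f f' -> is_weak_derivative f f'.
Proof.
move=> [ff' [cf1 cf2] _ _]; apply/is_weak_derivativeP; split=> phi tphi.
- exact: (Rintegral_by_parts_test (fun x => (ff' x).1)).
- exact: (Rintegral_by_parts_test (fun x => (ff' x).2)).
Qed.

Lemma H1C1_H1 f f' : H1C1 f f' -> H1 f.
Proof.
move=> ff'; split; first exact: H1C1_L2 ff'.
by exists f'; split; [exact: H1C1_L2' ff'|exact: H1C1_weak].
Qed.

Lemma H1C1_wderiv f f' : H1C1 f f' -> {ae mu, forall x, wderiv f x = f' x}.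
Proof.
move=> ff'; have [w2 wf] := wderivP (H1C1_H1 ff').
by apply: is_weak_derivative_unique wf (H1C1_weak ff') => //;
  exact: H1C1_L2' ff'.
Qed.

Lemma H1C1_H1norm f f' : H1C1 f f' ->
  H1norm f = Num.sqrt (L2norm f ^+ 2 + L2norm f' ^+ 2).
Proof.
move=> ff'; have [w2 wf] := wderivP (H1C1_H1 ff'); rewrite /H1norm.
by rewrite (ae_eq_L2norm w2 (H1C1_L2' ff') (H1C1_wderiv ff')).
Qed.

(** Here [f] has a classical derivative and [v] only a weak one; each of the four products of real
    and imaginary parts is an instance of [weak_derivative_by_parts]. *)
Lemma H1C1_by_parts f f' v : H1C1 f f' -> H1 v ->
  cintegral (fun x => f' x * v x) = - cintegral (fun x => f x * wderiv v x).
Proof.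
move=> [ff' [c1 c2] [f1 f2] [f1' f2']] Hv; have [[v1 v2] _] := Hv.
have [[w1 w2] /is_weak_derivativeP[u1 u2]] := wderivP Hv.
have d1 := fun x => (ff' x).1; have d2 := fun x => (ff' x).2.
have e11 := weak_derivative_by_parts d1 c1 f1 f1' v1 w1 u1.
have e12 := weak_derivative_by_parts d1 c1 f1 f1' v2 w2 u2.
have e21 := weak_derivative_by_parts d2 c2 f2 f2' v1 w1 u1.
have e22 := weak_derivative_by_parts d2 c2 f2 f2' v2 w2 u2.
apply: complex_eq; rewrite ?ReN ?ImN /=.
- under eq_Rintegral do rewrite ReM mulrC [X in _ - X]mulrC.
  under [in RHS]eq_Rintegral do rewrite ReM mulrC [X in _ - X]mulrC.
  by rewrite !RintegralB ?e11 ?e22 ?opprB//; try exact: integrable_mul;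
    rewrite opprK addrC.
- under eq_Rintegral do rewrite ImM mulrC [X in _ + X]mulrC.
  under [in RHS]eq_Rintegral do rewrite ImM mulrC [X in _ + X]mulrC.
  by rewrite !RintegralD ?e12 ?e21 ?opprD//; exact: integrable_mul.
Qed.

(** [Hm1_dxx] pairs the chosen weak derivatives. That of [f] agrees with [f'] almost everywhere, and
    the one on [v] is moved onto [f'] by parts. *)
Lemma H1C1_Hm1_dxx f f' f'' v : H1C1 f f' -> H1C1 f' f'' -> H1 v ->
  Hm1_dxx f v = cintegral (fun x => f'' x * v x).
Proof.
move=> ff' ff'' Hv; rewrite (H1C1_by_parts ff'' Hv) /Hm1_dxx; congr (- _).
have [v2 _] := wderivP Hv; have [w2 _] := wderivP (H1C1_H1 ff').
have cm h : L2 h -> cmeasurable (fun x => h x * wderiv v x).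
  move=> h2; have [i1 i2] := L2_cintegrable h2 v2.
  by split; apply/measurable_EFinP; [exact: measurable_int i1|exact:
    measurable_int i2].
apply: ae_eq_cintegral; [exact: cm|by apply: cm; exact: H1C1_L2' ff'|].
have := H1C1_wderiv ff'; apply: filterS; first exact: (ae_filter_ringOfSetsType
  mu).
by move=> x ->.
Qed.

End complex_integral.

(** * Norm estimates from a pointwise majorant *)

Section bounds.
Context {R : realType}.
Notation mu := (@lebesgue_measure R).
Implicit Types (f g h v : R -> R[i]) (z w : R[i]) (K : R).

Local Notation Re := (@complex.Re R).
Local Notation Im := (@complex.Im R).

Lemma cabs2E f x : cabs2 f x = Normc.normc (f x) ^+ 2.
Proof. by rewrite sqr_Normc. Qed.

Definition dominated f K := forall x : R, Normc.normc (f x) <= K * (oneDsqr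
  x)^-1.

Definition oneDsqrV_mass : R := \int[mu]_x (oneDsqr x)^-1.

Lemma dominated_ge0 f K : dominated f K -> 0 <= K.
Proof.
move=> /(_ 0) h; have := le_trans (normc_ge0 _) h.
by rewrite /oneDsqr expr0n addr0 invr1 mulr1.
Qed.

Lemma dominated_L2 f K : cmeasurable f -> dominated f K -> L2 f.
Proof.
move=> [m1 m2] fK; split.
- apply: (Lfun2_le_oneDsqrV (K := K)) => // x.
  exact: le_trans (normRe_le _) (fK x).
- apply: (Lfun2_le_oneDsqrV (K := K)) => // x.
  exact: le_trans (normIm_le _) (fK x).
Qed.

Lemma dominated_L2norm f K : cmeasurable f -> dominated f K ->
  L2norm f ^+ 2 <= K ^+ 2 * oneDsqrV_mass.
Proof.
move=> mf fK; have f2 := dominated_L2 mf fK;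
  rewrite sqr_L2norm// -RintegralZl//; last first.
  exact: integrable_oneDsqrV.
apply: le_Rintegral => //; first exact: integrable_cabs2.
  exact: integrable_ZoneDsqrV.
move=> x _; rewrite cabs2E.
have := lerXn2r 2 _ _ (fK x); rewrite !nnegrE => /(_ (normc_ge0 _)) h.
apply: le_trans (h (le_trans (normc_ge0 _) (fK x))) _.
rewrite exprMn ler_wpM2l ?sqr_ge0// exprS ler_piMr//.
exact: oneDsqrV_le1.
Qed.

(** The bound has only to be linear in [K] and uniform for [v] in the unit ball of H^1, so Young's
    inequality replaces Cauchy-Schwarz. The real and the imaginary part each contribute half of
    [K]. *)
Lemma dominated_cintegral f v K : cmeasurable f -> dominated f K -> L2 v ->
  Normc.normc (cintegral (fun x => f x * v x)) <=
  K * (oneDsqrV_mass + L2norm v ^+ 2).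
Proof.
move=> mf fK v2; have f2 := dominated_L2 mf fK; have K0 := dominated_ge0 fK.
have ic := integrable_cabs2 v2.
have ib : mu.-integrable setT (EFin \o (fun x => K / 2 * ((oneDsqr x)^-1 +
  cabs2 v x))).
  by apply: integrable_mulf; apply: integrable_addf => //;
    exact: integrable_oneDsqrV.
have bE : \int[mu]_x (K / 2 * ((oneDsqr x)^-1 + cabs2 v x)) =
    K / 2 * (oneDsqrV_mass + L2norm v ^+ 2).
  rewrite RintegralZl//; last exact: (integrable_addf (integrable_oneDsqrV) ic).
  by rewrite RintegralD//; [rewrite sqr_L2norm|exact: integrable_oneDsqrV].
have pt x : Normc.normc (f x * v x) <= K / 2 * ((oneDsqr x)^-1 + cabs2 v x).
  rewrite Normc.normcM; set n := Normc.normc (v x).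
  apply: (@le_trans _ _ (K * (oneDsqr x)^-1 * n)).
    by rewrite ler_wpM2r ?normc_ge0.
  rewrite cabs2E -/n.
  rewrite (_ : _ * n = K / 2 * (2 * (oneDsqr x)^-1 * n)); last by field;
    rewrite gt_eqF// (lt_le_trans ltr01) ?oneDsqr_ge1.
  rewrite ler_wpM2l ?divr_ge0//.
  have w1 := oneDsqrV_le1 x; have w0 : 0 <= (oneDsqr x)^-1 by [].
  rewrite /= in w1; move: w1 w0; move: (oneDsqr x)^-1 => w w1 w0.
  (* 2 w n <= w ^ 2 + n ^ 2 <= w + n ^ 2 *)
  have := sqr_ge0 (w - n); rewrite sqrrB; nra.
have [i1 i2] := L2_cintegrable f2 v2.
apply: le_trans (normc_le_ReIm _) _ => /=.
rewrite (_ : K * _ = K / 2 * (oneDsqrV_mass + L2norm v ^+ 2) +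
  K / 2 * (oneDsqrV_mass + L2norm v ^+ 2)); last by field.
rewrite -bE; apply: lerD.
- apply: le_trans (le_normr_Rintegral measurableT i1) _.
  apply: le_Rintegral => //; first exact: integrable_norm i1.
  by move=> x _; exact: le_trans (normRe_le _) (pt x).
- apply: le_trans (le_normr_Rintegral measurableT i2) _.
  apply: le_Rintegral => //; first exact: integrable_norm i2.
  by move=> x _; exact: le_trans (normIm_le _) (pt x).
Qed.

Lemma H1C1_0 : H1C1 (fun=> 0 : R[i]) (fun=> 0).
Proof.
by split; [exact: is_cderive_cst|split; exact: cst_continuous|split;
  exact: Lfun2_0..].
Qed.

Lemma H1norm_ge0 f : 0 <= H1norm f.
Proof. exact: sqrtr_ge0. Qed.

Lemma L2norm_le_H1norm f : L2norm f <= H1norm f.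
Proof.
rewrite /H1norm -[leLHS]ger0_norm ?L2norm_ge0// -sqrtr_sqr ler_wsqrtr//.
by rewrite lerDl sqr_ge0.
Qed.

Lemma L2norm0 : L2norm (fun=> 0 : R[i]) = 0.
Proof.
apply/eqP; rewrite -(@sqrf_eq0 R) sqr_L2norm; last exact: H1C1_L2 H1C1_0.
by under eq_Rintegral do rewrite /cabs2 /= expr0n addr0;
  rewrite Rintegral_cst// mul0r.
Qed.

(** The supremum includes the value at v = 0, so it is nonnegative even for an arbitrary functional
    [l]; this is the lower side of the squeeze for limits in H^{-1}. *)
Lemma Hm1norm_ge0 (l : (R -> R[i]) -> R[i]) : (0 <= Hm1norm l)%E.
Proof.
apply: (@le_trans _ _ (Normc.normc (l (fun=> 0)))%:E);
  first by rewrite lee_fin normc_ge0.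
apply: ereal_sup_ubound; exists (fun=> 0) => //; split;
  first exact: H1C1_H1 H1C1_0.
by rewrite (H1C1_H1norm H1C1_0) L2norm0 expr0n addr0 sqrtr0.
Qed.

Lemma Hm1norm_le (l : (R -> R[i]) -> R[i]) f K : cmeasurable f -> dominated f K
  ->
  (forall v, H1 v -> l v = cintegral (fun x => f x * v x)) ->
  (Hm1norm l <= (K * (oneDsqrV_mass + 1))%:E)%E.
Proof.
move=> mf fK lE; apply: ge_ereal_sup => _ [v [Hv v1] <-].
rewrite lee_fin lE//; have [v2 _] := Hv.
apply: le_trans (dominated_cintegral mf fK v2) _.
rewrite ler_wpM2l ?(dominated_ge0 fK)// lerD2l.
by rewrite expr_le1 ?L2norm_ge0// (le_trans (L2norm_le_H1norm v)).
Qed.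

Lemma H1C1_H1norm_le f f' K : H1C1 f f' -> dominated f K -> dominated f' K ->
  H1norm f <= K * Num.sqrt (2 * oneDsqrV_mass).
Proof.
move=> ff' fK fK'; rewrite (H1C1_H1norm ff').
rewrite -[K in leRHS]ger0_norm ?(dominated_ge0 fK)// -sqrtr_sqr -sqrtrM
  ?sqr_ge0//.
have mf h (h2 : L2 h) := L2_cmeasurable h2.
rewrite ler_wsqrtr// mulrCA mulr_natl mulr2n lerD// dominated_L2norm//.
- exact: mf (H1C1_L2 ff').
- exact: mf (H1C1_L2' ff').
Qed.

(** A triangle inequality without roots: pointwise, 2 (p - q)^2 + 2 q^2 - p^2 = (p - 2 q)^2. *)
Lemma L2norm_triangle f g : L2 f -> L2 g ->
  L2norm f ^+ 2 <= 2 * L2norm (f \- g) ^+ 2 + 2 * L2norm g ^+ 2.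
Proof.
move=> f2 g2; have fg2 := L2B f2 g2.
rewrite !sqr_L2norm// -!RintegralZl//; [|exact: integrable_cabs2..].
have i1 := integrable_mulf 2 (integrable_cabs2 fg2).
have i2 := integrable_mulf 2 (integrable_cabs2 g2).
rewrite -RintegralD//; apply: le_Rintegral => //.
- exact: integrable_cabs2.
- exact: integrable_addf.
- move=> x _; rewrite /cabs2 !ReD !ImD !ReN !ImN.
  have := sqr_ge0 (Re (f x) - 2 * Re (g x));
    have := sqr_ge0 (Im (f x) - 2 * Im (g x)).
  nra.
Qed.

End bounds.

(** * Elementary inequalities for sine, cosine and the exponential *)

Section elementary_bounds.
Context {R : realType}.
Implicit Types (x y h : R) (z w : R[i]) (f : R -> R).

Lemma is_derive_bounded f f' (B h : R) : (forall x : R, is_derive x 1 f (f' x))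
  ->
  (forall x, `|x| <= `|h| -> `|f' x| <= B) -> f 0 = 0 -> `|f h| <= B * `|h|.
Proof.
move=> ff' fB f0; have cf := is_derive_continuous ff'.
have [h0|h0] := leP 0 h.
  have [c /itvP c_ ] := MVT_segment h0 (fun x _ => ff' x) (continuous_subspaceT
    cf).
  rewrite f0 !subr0 => ->; rewrite normrM ler_wpM2r// fB//.
  by rewrite !ger0_norm ?c_.
have [c /itvP c_ ] := MVT_segment (ltW h0) (fun x _ => ff' x)
  (continuous_subspaceT cf).
rewrite f0 !sub0r => /eqP; rewrite eqr_oppLR => /eqP ->;
  rewrite normrN normrM normrN ler_wpM2r// fB//.
by rewrite !ler0_norm ?lerN2 ?c_ ?(ltW h0).
Qed.

Lemma norm_sin_le h : `|sin h| <= `|h|.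
Proof.
rewrite -[leRHS]mul1r; apply: (is_derive_bounded (fun x => is_derive_sin x));
  last exact: sin0.
by move=> x _; exact: cos_max.
Qed.

(** The derivative - sin is bounded by |h| on the segment, so the mean value theorem gains one power
    of |h|. The bound on sin h - h below follows likewise from [norm_cosB1_le1]. *)
Lemma norm_cosB1_le h : `|cos h - 1| <= h ^+ 2.
Proof.
rewrite -real_normK ?num_real// expr2.
apply: (@is_derive_bounded (fun x => cos x - 1) (fun x => - sin x)).
- move=> x; apply: is_derive_eq (is_derive_subf (is_derive_cos x)
  (is_derive_cstf 1 x)) _.
  by rewrite subr0.
- by move=> x xh; rewrite normrN (le_trans (norm_sin_le x)).
- by rewrite cos0 subrr.
Qed.

Lemma norm_cosB1_le1 h : `|cos h - 1| <= `|h|.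
Proof.
rewrite -[leRHS]mul1r.
apply: (@is_derive_bounded (fun x => cos x - 1) (fun x => - sin x)).
- move=> x; apply: is_derive_eq (is_derive_subf (is_derive_cos x)
  (is_derive_cstf 1 x)) _.
  by rewrite subr0.
- by move=> x xh; rewrite normrN; exact: sin_max.
- by rewrite cos0 subrr.
Qed.

Lemma norm_sinBid_le h : `|sin h - h| <= h ^+ 2.
Proof.
rewrite -real_normK ?num_real// expr2.
apply: (@is_derive_bounded (fun x => sin x - x) (fun x => cos x - 1)).
- by move=> x xh; exact: le_trans (norm_cosB1_le1 x) xh.
- by rewrite sin0 subrr.
Qed.

Definition cis x : R[i] := Complex (cos x) (sin x).

Lemma cisD x y : cis (x + y) = cis x * cis y.
Proof. by apply: complex_eq; rewrite ?ReM ?ImM /= ?cosD ?sinD//; ring. Qed.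

Lemma conj_cis x : conjc (cis x) = cis (- x).
Proof. by rewrite /cis /= cosN sinN. Qed.

Lemma cis0 : cis 0 = 1. Proof. by rewrite /cis cos0 sin0. Qed.

Lemma normc_cis x : Normc.normc (cis x) = 1.
Proof. by rewrite /= cos2Dsin2 sqrtr1. Qed.

Lemma cis_neq0 x : cis x != 0.
Proof.
by apply/eqP => h; have := normc_cis x; rewrite h Normc.normc0 => /eqP;
  rewrite eq_sym oner_eq0.
Qed.

Lemma cisV x : (cis x)^-1 = cis (- x).
Proof. by apply: (mulfI (cis_neq0 x)); rewrite -cisD divff ?cis_neq0// subrr
  cis0. Qed.

Lemma normc_cisB1 h : Normc.normc (cis h - 1) <= 2 * `|h|.
Proof.
apply: le_trans (normc_le_ReIm _) _; rewrite ReD ImD ReN ImN /= subr0.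
have := norm_cosB1_le1 h; have := norm_sin_le h; lra.
Qed.

Lemma normc_cisB1B h :
  Normc.normc (cis h - 1 - Complex 0 h) <= 2 * h ^+ 2.
Proof.
apply: le_trans (normc_le_ReIm _) _; rewrite !ReD !ImD !ReN !ImN /= !subr0.
have := norm_cosB1_le h; have := norm_sinBid_le h; lra.
Qed.

(** e^y is the square of e^{y/2} >= 1 + y/2. *)
Lemma expR_ge_sqr y : 0 <= y -> 1 + y ^+ 2 / 4 <= expR y.
Proof.
move=> y0; have -> : y = y / 2 + y / 2 by field.
rewrite expRD; have := @expR_ge1Dx R (y / 2).
have : 0 <= y / 2 by rewrite divr_ge0.
move: (y / 2) (expR (y / 2)) => u v u0 uv; nra.
Qed.

(** The constant is chosen so that (1 + 4/b^2) (1 + b^2 x^2 / 4) >= 1 + x^2; the second factor is at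
    most e^{b|x|} by [expR_ge_sqr]. *)
Lemma expRN_norm_le (b x : R) : 0 < b ->
  expR (- (b * `|x|)) <= (1 + 4 / b ^+ 2) * (oneDsqr x)^-1.
Proof.
move=> b0; have ox : 0 < oneDsqr x by rewrite (lt_le_trans ltr01)// oneDsqr_ge1.
rewrite expRN ler_pdivlMr// mulrC ler_pdivrMr ?expR_gt0//.
have bx : 0 <= b * `|x| by rewrite mulr_ge0// ltW.
have b20 : 0 < 4 / b ^+ 2 by rewrite divr_gt0// exprn_gt0.
apply: (@le_trans _ _ ((1 + 4 / b ^+ 2) * (1 + (b * `|x|) ^+ 2 / 4)));
  last first.
  by rewrite ler_wpM2l ?expR_ge_sqr// addr_ge0// ltW.
rewrite exprMn real_normK ?num_real// /oneDsqr.
rewrite (_ : _ * (1 + _) = (1 + x ^+ 2) + (4 / b ^+ 2 + b ^+ 2 * x ^+ 2 / 4));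
  last first.
  by field; rewrite gt_eqF.
rewrite lerDl (addr_ge0 (ltW b20))// divr_ge0//; apply: mulr_ge0;
  exact: sqr_ge0.
Qed.

End elementary_bounds.

(** * The explicit solution *)

Section explicit_solution.
Context {R : realType}.
Variables (al be A : R).
Hypotheses (al_gt0 : 0 < al) (be_gt0 : 0 < be) (A2 : A ^+ 2 = 2 * (al + be) ^+
  2).
Implicit Types (t x s : R).

Local Notation RC := (real_complex R).
Local Notation I := (Complex 0 1 : R[i]).

(* [bP], [bQ] and [bD] are P, Q and P + Q above; [bexp] is |P| + |Q|. *)
Definition bexp x : R := expR (al * x) + expR (- (be * x)).
Definition bP t x : R[i] := RC (expR (al * x)) * cis (- (al ^+ 2 * t)).
Definition bQ t x : R[i] := RC (expR (- (be * x))) * cis (- (be ^+ 2 * t)).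
Definition bD t x : R[i] := bP t x + bQ t x.

Definition bsol t x : R[i] := RC A / bD t x.
(** Closed forms of u_x, u_xx and u_t, read off from P_x = al P, Q_x = - be Q, P_t = - i al^2 P and
    Q_t = - i be^2 Q. *)
Definition bsol_x t x : R[i] :=
  - (RC A * (RC al * bP t x - RC be * bQ t x)) / bD t x ^+ 2.
Definition bsol_xx t x : R[i] :=
  RC A * (2 * (RC al * bP t x - RC be * bQ t x) ^+ 2 / bD t x ^+ 3 -
          (RC al ^+ 2 * bP t x + RC be ^+ 2 * bQ t x) / bD t x ^+ 2).
Definition bsol_t t x : R[i] :=
  RC A * I * (RC al ^+ 2 * bP t x + RC be ^+ 2 * bQ t x) / bD t x ^+ 2.

Lemma RC_neq0 x : x != 0 -> RC x != 0.
Proof. by move=> x0; rewrite fmorph_eq0. Qed.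

Lemma bP_neq0 t x : bP t x != 0.
Proof. by rewrite mulf_neq0 ?cis_neq0// RC_neq0// gt_eqF ?expR_gt0. Qed.

Lemma bQ_neq0 t x : bQ t x != 0.
Proof. by rewrite mulf_neq0 ?cis_neq0// RC_neq0// gt_eqF ?expR_gt0. Qed.

Lemma conjcM (z w : R[i]) : conjc (z * w) = conjc z * conjc w.
Proof. exact: rmorphM. Qed.

Lemma conjcD (z w : R[i]) : conjc (z + w) = conjc z + conjc w.
Proof. exact: rmorphD. Qed.

(** Reflection reverses the real exponent and conjugation the phase; together they invert P, and
    likewise Q. This is how the nonlocal nonlinearity becomes a rational function of P and Q. *)
Lemma conj_bP t x : conjc (bP t (- x)) = (bP t x)^-1.
Proof.
by rewrite /bP conjcM conjc_real conj_cis invfM cisV -fmorphV -expRN mulrN.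
Qed.

Lemma conj_bQ t x : conjc (bQ t (- x)) = (bQ t x)^-1.
Proof.
by rewrite /bQ conjcM conjc_real conj_cis invfM cisV -fmorphV -expRN mulrN.
Qed.

(** Over the denominator (P + Q)^3 the left side has numerator A P Q (A^2 - 2 (al + be)^2), zero by
    the choice of A. *)
Lemma bsol_equation t x : bD t x != 0 ->
  I * bsol_t t x + bsol_xx t x + nonlinearity (bsol t) x = 0.
Proof.
move=> D0; have P0 := bP_neq0 t x; have Q0 := bQ_neq0 t x.
rewrite /nonlinearity /bsol /bsol_t /bsol_xx conjcM conjc_real conjc_inv.
rewrite [bD t (- x)]/bD conjcD conj_bP conj_bQ.
have I2 : I * I = -1 by rewrite -expr2 sqr_i.
have A2c : RC A ^+ 2 = 2 * (RC al + RC be) ^+ 2.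
  have R2 : RC 2 = 2 by exact: (rmorph_nat (real_complex R) 2).
  by rewrite -rmorphXn A2 rmorphM rmorphXn (rmorphD _ al be) -R2.
move: D0 A2c; rewrite /bD; move: (bP t x) (bQ t x) P0 Q0 => P Q P0 Q0 D0 A2c.
rewrite exprMn A2c.
rewrite (_ : I * _ = (I * I) * (RC A * (RC al ^+ 2 * P + RC be ^+ 2 * Q) / (P +
  Q) ^+ 2)); last by ring.
rewrite I2; field.
by rewrite Q0 P0 addrC D0.
Qed.

Lemma is_cderive_expR (k : R) (z : R[i]) :
  is_cderive (fun x => RC (expR (k * x)) * z) (fun x => RC k * (RC (expR (k *
    x)) * z)).
Proof.
move=> x; have dk : is_derive x 1 (fun y : R => expR (k * y)) (k * expR (k *
  x)).
  apply: is_derive_eq (is_derive_compf (is_derive_expR _) (is_derive_mulf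
    (is_derive_cstf k x) (is_derive_idf x))) _.
  by ring.
split.
- under eq_fun do rewrite ReM /= mul0r subr0.
  apply: is_derive_eq (is_derive_mulf dk (is_derive_cstf (complex.Re z) x)) _.
  by rewrite !ReM !ImM /=; ring.
- under eq_fun do rewrite ImM /= mul0r addr0.
  apply: is_derive_eq (is_derive_mulf dk (is_derive_cstf (complex.Im z) x)) _.
  by rewrite !ImM !ReM /=; ring.
Qed.

Lemma is_cderive_bP t : is_cderive (bP t) (fun x => RC al * bP t x).
Proof. exact: is_cderive_expR. Qed.

Lemma is_cderive_bQ t : is_cderive (bQ t) (fun x => - RC be * bQ t x).
Proof.
have h := is_cderive_expR (- be) (cis (- (be ^+ 2 * t))).
have bE : (fun x => RC (expR (- be * x)) * cis (- (be ^+ 2 * t))) = bQ t.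
  by apply/funext => x; rewrite /bQ mulNr.
rewrite bE in h; move=> x; have := h x.
by rewrite (_ : RC (- be) * _ = - RC be * bQ t x)// -bE rmorphN.
Qed.

Lemma is_cderive_bD t : is_cderive (bD t) (fun x => RC al * bP t x - RC be * bQ
  t x).
Proof.
have := is_cderiveD (is_cderive_bP t) (is_cderive_bQ t).
by under [X in is_cderive _ X]eq_fun do rewrite mulNr.
Qed.

Lemma is_cderive_bsol t : (forall x, bD t x != 0) -> is_cderive (bsol t)
  (bsol_x t).
Proof.
move=> D0; have := is_cderiveZ (RC A) (is_cderiveV D0 (is_cderive_bD t)).
rewrite (_ : (fun x => RC A * (- _ / _)) = bsol_x t)//.
by apply/funext => x; rewrite /bsol_x mulrA mulrN.
Qed.

Lemma is_cderive_bsol_x t : (forall x, bD t x != 0) ->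
  is_cderive (bsol_x t) (bsol_xx t).
Proof.
move=> D0.
have dD' := is_cderiveD (is_cderiveZ (RC al) (is_cderive_bP t))
  (is_cderiveZ (- RC be) (is_cderive_bQ t)).
have dV := is_cderiveV D0 (is_cderive_bD t).
have := is_cderiveZ (- RC A) (is_cderiveM (is_cderiveM dD' dV) dV).
rewrite (_ : (fun x => - RC A * (_ * _ * _)) = bsol_x t); last first.
  by apply/funext => x; rewrite /bsol_x; field.
rewrite (_ : (fun x => - RC A * (_ + _)) = bsol_xx t)//.
by apply/funext => x; rewrite /bsol_xx /bD; field; exact: D0.
Qed.

Lemma ccontinuousV f : (forall x, f x != 0) -> ccontinuous f ->
  ccontinuous (fun x : R => (f x : R[i])^-1).
Proof.
move=> f0 [c1 c2].
have cN : forall x, (complex.Re (f y) ^+ 2 + complex.Im (f y) ^+ 2)^-1 @[y -->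
  x] -->
    (complex.Re (f x) ^+ 2 + complex.Im (f x) ^+ 2)^-1.
  move=> x; apply: cvgV; first by rewrite sqr_normc_eq0.
  by apply: cvgD; [exact: (cvgM (c1 x) (c1 x))|exact: (cvgM (c2 x) (c2 x))].
split=> x.
- by under eq_fun do rewrite ReV; apply: cvgM; [exact: c1|exact: cN].
- by under eq_fun do rewrite ImV; apply: cvgM; [apply: cvgN;
  exact: c2|exact: cN].
Qed.

End explicit_solution.

(** * Lower bound on |P + Q| and Lipschitz estimates in time *)

Section time_regularity.
Context {R : realType}.
Variables (al be A : R).
Hypotheses (al_gt0 : 0 < al) (al_le_be : al <= be) (A_gt0 : 0 < A).
Implicit Types (t x s : R) (z w : R[i]) (g : R -> R -> R[i]).

Local Notation RC := (real_complex R).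
Local Notation I := (Complex 0 1 : R[i]).
Local Notation Nc := (@Normc.normc R).
Local Notation bexp := (bexp al be).
Local Notation bP := (bP al).
Local Notation bQ := (bQ be).
Local Notation bD := (bD al be).
Local Notation bsol := (bsol al be A).
Local Notation bsol_x := (bsol_x al be A).
Local Notation bsol_xx := (bsol_xx al be A).
Local Notation bsol_t := (bsol_t al be A).

(** Half the difference of the angular frequencies of Q and P: [kappa * t] is the angle th. *)
Definition kappa : R := (be ^+ 2 - al ^+ 2) / 2.

Lemma sqr_normc_bD t x : Nc (bD t x) ^+ 2 =
  (expR (al * x) + expR (- (be * x))) ^+ 2 * cos (kappa * t) ^+ 2 +
  (expR (al * x) - expR (- (be * x))) ^+ 2 * sin (kappa * t) ^+ 2.
Proof.
rewrite sqr_Normc /bD /bP /bQ ReD ImD !ReM !ImM /= !mul0r !subr0 !addr0 !cosN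
  !sinN.
(* The phases of P and Q are -(m - th) and -(m + th); the common phase -m does not change the
   modulus of the sum. *)
pose m := (be ^+ 2 + al ^+ 2) / 2 * t.
have -> : al ^+ 2 * t = m - kappa * t by rewrite /m /kappa; field.
have -> : be ^+ 2 * t = m + kappa * t by rewrite /m /kappa; field.
rewrite cosB sinB cosD sinD; move: (kappa * t) (expR _) (expR _) => y p q.
transitivity (((p + q) ^+ 2 * cos y ^+ 2 + (p - q) ^+ 2 * sin y ^+ 2) *
  (cos m ^+ 2 + sin m ^+ 2)); first by ring.
by rewrite cos2Dsin2 mulr1; ring.
Qed.

Lemma bexp_gt0 x : 0 < bexp x.
Proof. by rewrite addr_gt0 ?expR_gt0. Qed.

Lemma bD_ge (c t x : R) : 0 <= c -> c <= cos (kappa * t) -> c * bexp x <= Nc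
  (bD t x).
Proof.
move=> c0 ct; rewrite -(ler_pXn2r (n := 2)) ?nnegrE ?normc_ge0 ?mulr_ge0 ?(ltW
  (bexp_gt0 x))//.
rewrite sqr_normc_bD exprMn (mulrC (c ^+ 2)) -[leLHS]addr0 lerD//; last first.
  by rewrite mulr_ge0 ?sqr_ge0.
by apply: ler_wpM2l; rewrite ?sqr_ge0// lerXn2r ?nnegrE// (le_trans c0).
Qed.

Lemma bD_neq0 t x : 0 < cos (kappa * t) -> bD t x != 0.
Proof.
move=> ct; apply/eqP => D0; have := bD_ge x (ltW ct) (lexx _).
by rewrite D0 Normc.normc0 leNgt mulr_gt0 ?bexp_gt0.
Qed.

(** The term that grows with |x| is at least e^{al |x|}: for x < 0 this uses al <= be. *)
Lemma bexpV_le x : (bexp x)^-1 <= (1 + 4 / al ^+ 2) * (oneDsqr x)^-1.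
Proof.
apply: le_trans (expRN_norm_le x al_gt0).
rewrite expRN lef_pV2 ?posrE ?bexp_gt0 ?expR_gt0// /bexp.
have [x0|x0] := leP 0 x; first by rewrite (ger0_norm x0) ler_wpDr ?expR_ge0.
rewrite (ltr0_norm x0) ler_wpDl ?expR_ge0// ler_expR -mulrN.
by rewrite ler_wpM2r// oppr_ge0 ltW.
Qed.

Lemma normc_cisB (k s t : R) : Nc (cis (k * s) - cis (k * t)) <= 2 * `|k| * `|s
  - t|.
Proof.
have -> : cis (k * s) - cis (k * t) = cis (k * t) * (cis (k * (s - t)) - 1).
  by rewrite mulrBr mulr1 -cisD -mulrDr (addrC t) subrK.
rewrite Normc.normcM normc_cis mul1r; apply: le_trans (normc_cisB1 _) _.
by rewrite normrM mulrA.
Qed.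

Variable c : R.
Hypothesis c_gt0 : 0 < c.

(* A class stable under the ring operations, so that the estimates in time of
   the solution and of its derivatives follow from those of P / (|P| + |Q|) and
   Q / (|P| + |Q|); the inverse of their sum is handled by the lower bound c. *)
Definition regular g := exists C, forall s t, c <= cos (kappa * s) ->
  c <= cos (kappa * t) -> forall x,
  Nc (g t x) <= C /\ Nc (g s x - g t x) <= C * `|s - t|.

Lemma regular_cst z : regular (fun _ _ => z).
Proof.
exists (Nc z) => s t _ _ x; split => //.
by rewrite subrr Normc.normc0 mulr_ge0 ?normc_ge0.
Qed.

Lemma regularD g1 g2 : regular g1 -> regular g2 ->
  regular (fun t x => g1 t x + g2 t x).
Proof.
move=> [C1 h1] [C2 h2]; exists (C1 + C2) => s t hs ht x.
have [u1 v1] := h1 s t hs ht x; have [u2 v2] := h2 s t hs ht x; split.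
  by apply: le_trans (le_normcD _ _) _; exact: lerD.
rewrite mulrDl opprD addrACA.
by apply: le_trans (le_normcD _ _) _; exact: lerD.
Qed.

Lemma regularM g1 g2 : regular g1 -> regular g2 ->
  regular (fun t x => g1 t x * g2 t x).
Proof.
move=> [C1 h1] [C2 h2]; exists (C1 * C2 + C1 * C2) => s t hs ht x.
have [u1 v1] := h1 s t hs ht x; have [u2 v2] := h2 s t hs ht x.
have [us1 _] := h1 s s hs hs x.
have C10 : 0 <= C1 := le_trans (normc_ge0 _) u1.
have C20 : 0 <= C2 := le_trans (normc_ge0 _) u2.
split.
  rewrite Normc.normcM (le_trans (ler_pM _ _ u1 u2)) ?normc_ge0//.
  by rewrite lerDl mulr_ge0.
rewrite (_ : _ - _ = g1 s x * (g2 s x - g2 t x) + (g1 s x - g1 t x) * g2 t x);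
  last by ring.
apply: le_trans (le_normcD _ _) _; rewrite !Normc.normcM mulrDl; apply: lerD.
  by rewrite -mulrA ler_pM ?normc_ge0.
by rewrite -mulrA (mulrC C2) mulrA ler_pM ?normc_ge0.
Qed.

Lemma regularZ z g : regular g -> regular (fun t x => z * g t x).
Proof. exact: regularM (regular_cst z). Qed.

(** Where the moduli are at least [m], the identity 1/p - 1/q = - (p - q) / (p q) turns a Lipschitz
    bound for g into one for its inverse. *)
Lemma regularV g (m : R) : 0 < m ->
  (forall t x, c <= cos (kappa * t) -> m <= Nc (g t x)) ->
  regular g -> regular (fun t x => (g t x)^-1).
Proof.
move=> m0 gm [C h]; exists (m^-1 + m^-1 ^+ 2 * C) => s t hs ht x.
have [u v] := h s t hs ht x; have C0 : 0 <= C := le_trans (normc_ge0 _) u.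
have gms := gm s x hs; have gmt := gm t x ht.
have gV r : c <= cos (kappa * r) -> Nc (g r x)^-1 <= m^-1.
  move=> hr; have gmr := gm r x hr.
  by rewrite Normc.normcV lef_pV2 ?posrE// (lt_le_trans m0).
have g0 r : c <= cos (kappa * r) -> g r x != 0.
  move=> hr; apply/eqP => gr0; have := gm r x hr.
  by rewrite gr0 Normc.normc0 leNgt m0.
have mV0 : 0 <= m^-1 by rewrite invr_ge0 ltW.
split; first by rewrite (le_trans (gV t ht))// lerDl mulr_ge0// sqr_ge0.
have -> : (g s x)^-1 - (g t x)^-1 = - ((g s x)^-1 * (g t x)^-1 * (g s x - g t
  x)).
  by field; rewrite !g0.
rewrite normcN !Normc.normcM mulrDl ler_wpDl ?mulr_ge0// expr2 -(mulrA _ C).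
have := ler_pM (normc_ge0 _) (normc_ge0 _) (gV s hs) (gV t ht) => gst.
by apply: ler_pM => //; rewrite ?mulr_ge0 ?normc_ge0.
Qed.

(** Division by |P| + |Q| makes both exponentials bounded uniformly in x; [nV] below is (|P| + |Q|)
    / (P + Q). *)
Definition nP t x : R[i] := bP t x / RC (bexp x).
Definition nQ t x : R[i] := bQ t x / RC (bexp x).
Definition nV t x : R[i] := (nP t x + nQ t x)^-1.

Lemma RC_bexp_neq0 x : RC (bexp x) != 0.
Proof. by rewrite RC_neq0// gt_eqF ?bexp_gt0. Qed.

Lemma normc_RC_div (a b : R) : 0 <= a -> 0 < b -> Nc (RC a / RC b) = a / b.
Proof.
by move=> a0 b0; rewrite Normc.normcM Normc.normcV !normc_real !ger0_norm// ltW.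
Qed.

Lemma nPE t x : nP t x = RC (expR (al * x)) / RC (bexp x) * cis (- al ^+ 2 * t).
Proof. by rewrite /nP /bP mulrAC mulNr. Qed.

Lemma nQE t x : nQ t x = RC (expR (- (be * x))) / RC (bexp x) * cis (- be ^+ 2
  * t).
Proof. by rewrite /nQ /bQ mulrAC mulNr. Qed.

Lemma regular_cis (w : R -> R[i]) (k : R) : (forall x, Nc (w x) <= 1) ->
  regular (fun t x => w x * cis (k * t)).
Proof.
move=> w1; exists (1 + 2 * `|k|) => s t _ _ x; split.
  by rewrite Normc.normcM normc_cis mulr1 (le_trans (w1 x))// lerDl mulr_ge0.
rewrite -mulrBr Normc.normcM (le_trans (ler_piMl _ (w1 x))) ?normc_ge0//.
apply: le_trans (normc_cisB k s t) _.
by rewrite ler_wpM2r// lerDr.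
Qed.

Lemma nP_le1 x : Nc (RC (expR (al * x)) / RC (bexp x)) <= 1.
Proof.
rewrite normc_RC_div ?expR_ge0 ?bexp_gt0// ler_pdivrMr ?bexp_gt0// mul1r.
by rewrite lerDl expR_ge0.
Qed.

Lemma nQ_le1 x : Nc (RC (expR (- (be * x))) / RC (bexp x)) <= 1.
Proof.
rewrite normc_RC_div ?expR_ge0 ?bexp_gt0// ler_pdivrMr ?bexp_gt0// mul1r.
by rewrite lerDr expR_ge0.
Qed.

Lemma regular_nP : regular nP.
Proof.
have := regular_cis (- al ^+ 2) nP_le1.
by rewrite (_ : (fun _ _ => _) = nP)//; apply/funext => t; apply/funext => x;
  rewrite nPE.
Qed.

Lemma regular_nQ : regular nQ.
Proof.
have := regular_cis (- be ^+ 2) nQ_le1.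
by rewrite (_ : (fun _ _ => _) = nQ)//; apply/funext => t; apply/funext => x;
  rewrite nQE.
Qed.

Lemma nPDnQ t x : nP t x + nQ t x = bD t x / RC (bexp x).
Proof. by rewrite /nP /nQ -mulrDl. Qed.

Lemma nPDnQ_ge t x : c <= cos (kappa * t) -> c <= Nc (nP t x + nQ t x).
Proof.
move=> ct; rewrite nPDnQ Normc.normcM Normc.normcV normc_real gtr0_norm
  ?bexp_gt0//.
by rewrite ler_pdivlMr ?bexp_gt0// bD_ge// ltW.
Qed.

Lemma regular_nV : regular nV.
Proof.
apply: (regularV c_gt0); first by move=> t x; exact: nPDnQ_ge.
by apply: regularD; [exact: regular_nP|exact: regular_nQ].
Qed.

(** What is left of u_x, u_t and u_xx once the factor A / (|P| + |Q|) is taken out; for u itself it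
    is [nV]. All are polynomials in [nP], [nQ] and [nV], hence regular. *)
Definition profile_x t x := - (RC al * nP t x - RC be * nQ t x) * (nV t x * nV
  t x).
Definition profile_t t x := I * (RC al ^+ 2 * nP t x + RC be ^+ 2 * nQ t x) *
  (nV t x * nV t x).
Definition profile_xx t x := 2 * ((RC al * nP t x - RC be * nQ t x) *
   (RC al * nP t x - RC be * nQ t x) * (nV t x * nV t x * nV t x)) -
  (RC al ^+ 2 * nP t x + RC be ^+ 2 * nQ t x) * (nV t x * nV t x).

Lemma regularN g : regular g -> regular (fun t x => - g t x).
Proof.
move=> [C h]; exists C => s t hs ht x; have [u v] := h s t hs ht x.
by rewrite -opprD !normcN.
Qed.

Lemma regular_profile_x : regular profile_x.
Proof.
have rP := regular_nP; have rQ := regular_nQ; have rV := regular_nV.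
apply: regularM; last exact: regularM.
by apply: regularN; apply: regularD; [exact: regularZ|apply: regularN;
  exact: regularZ].
Qed.

Lemma regular_profile_t : regular profile_t.
Proof.
have rP := regular_nP; have rQ := regular_nQ; have rV := regular_nV.
apply: regularM; last exact: regularM.
by apply: regularZ; apply: regularD; exact: regularZ.
Qed.

Lemma regular_profile_xx : regular profile_xx.
Proof.
have rP := regular_nP; have rQ := regular_nQ; have rV := regular_nV.
have r1 : regular (fun t x => RC al * nP t x - RC be * nQ t x).
  by apply: regularD; [exact: regularZ|apply: regularN; exact: regularZ].
apply: regularD.
  by apply: regularZ; apply: regularM; apply: regularM => //; exact: regularM.
apply: regularN; apply: regularM; last exact: regularM.
by apply: regularD; exact: regularZ.
Qed.

Section normal_forms.
Variables (t x : R).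
Hypothesis ct : 0 < cos (kappa * t).

Let D0 : nP t x + nQ t x != 0.
Proof. by rewrite nPDnQ mulf_neq0 ?invr_eq0 ?bD_neq0// RC_bexp_neq0. Qed.

Let E0 := RC_bexp_neq0 x.
Let PE : bP t x = RC (bexp x) * nP t x.
Proof. by rewrite /nP mulrC divfK. Qed.
Let QE : bQ t x = RC (bexp x) * nQ t x.
Proof. by rewrite /nQ mulrC divfK. Qed.
Let AE : RC (A / bexp x) = RC A / RC (bexp x).
Proof. exact: fmorph_div. Qed.

Lemma bsolE : bsol t x = RC (A / bexp x) * nV t x.
Proof.
rewrite /bsol /bD PE QE AE /nV; move: E0 D0;
  move: (RC (bexp x)) (nP t x) (nQ t x).
by move=> E P Q h1 h2; field; rewrite h1 h2 -mulrDr mulf_neq0.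
Qed.

Lemma bsol_xE : bsol_x t x = RC (A / bexp x) * profile_x t x.
Proof.
rewrite /bsol_x /profile_x /bD PE QE AE /nV; move: E0 D0;
  move: (RC (bexp x)) (nP t x) (nQ t x).
by move=> E P Q h1 h2; field; rewrite h1 h2 -mulrDr mulf_neq0.
Qed.

Lemma bsol_tE : bsol_t t x = RC (A / bexp x) * profile_t t x.
Proof.
rewrite /bsol_t /profile_t /bD PE QE AE /nV; move: E0 D0;
  move: (RC (bexp x)) (nP t x) (nQ t x).
by move=> E P Q h1 h2; field; rewrite h1 h2 -mulrDr mulf_neq0.
Qed.

Lemma bsol_xxE : bsol_xx t x = RC (A / bexp x) * profile_xx t x.
Proof.
rewrite /bsol_xx /profile_xx /bD PE QE AE /nV; move: E0 D0;
  move: (RC (bexp x)) (nP t x) (nQ t x).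
by move=> E P Q h1 h2; field; rewrite h1 h2 -mulrDr mulf_neq0.
Qed.

End normal_forms.

Definition envelope : R := A * (1 + 4 / al ^+ 2).

Lemma envelope_dominated (f : R -> R[i]) (K : R) :
  (forall x, Nc (f x) <= K) -> dominated (fun x => RC (A / bexp x) * f x) (K *
    envelope).
Proof.
move=> fK x; have K0 := le_trans (normc_ge0 _) (fK x).
rewrite Normc.normcM normc_real ger0_norm ?divr_ge0 ?(ltW A_gt0) ?(ltW
  (bexp_gt0 x))//.
rewrite mulrC /envelope -!mulrA; apply: ler_pM => //; first exact: normc_ge0.
  by rewrite divr_ge0 ?(ltW A_gt0) ?(ltW (bexp_gt0 x)).
by rewrite ler_wpM2l ?(ltW A_gt0)// bexpV_le.
Qed.

Lemma regular_dominated g : regular g -> exists K, forall s t,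
  c <= cos (kappa * s) -> c <= cos (kappa * t) ->
  dominated (fun x => RC (A / bexp x) * g t x) K /\
  dominated (fun x => RC (A / bexp x) * g s x - RC (A / bexp x) * g t x) (K *
    `|s - t|).
Proof.
move=> [C h]; exists (C * envelope) => s t hs ht; split.
  by apply: envelope_dominated => x; have [] := h s t hs ht x.
have : dominated (fun x => RC (A / bexp x) * (g s x - g t x)) (C * `|s - t| *
  envelope).
  by apply: envelope_dominated => x; have [] := h s t hs ht x.
by move=> hd x; rewrite -mulrBr (le_trans (hd x))// (mulrAC C).
Qed.

(** Pulling out e^{ikt} reduces the claim to the expansion of [cis] at 0. *)
Lemma normc_taylor (w : R -> R[i]) (k s t x : R) : Nc (w x) <= 1 ->
  Nc (w x * cis (k * s) - w x * cis (k * t) -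
      RC (s - t) * (I * RC k * (w x * cis (k * t)))) <= 2 * k ^+ 2 * (s - t) ^+
        2.
Proof.
move=> w1.
have -> : w x * cis (k * s) - w x * cis (k * t) -
    RC (s - t) * (I * RC k * (w x * cis (k * t))) =
    w x * cis (k * t) * (cis (k * (s - t)) - 1 - Complex 0 (k * (s - t))).
  have -> : Complex 0 (k * (s - t)) = I * RC k * RC (s - t).
    by apply: complex_eq; rewrite !(ReM, ImM) /=; ring.
  have -> : cis (k * s) = cis (k * t) * cis (k * (s - t)).
    by rewrite -cisD -mulrDr (addrC t) subrK.
  by ring.
rewrite !Normc.normcM normc_cis mulr1 (le_trans (ler_piMl _ w1)) ?normc_ge0//.
by rewrite (le_trans (normc_cisB1B _))// exprMn mulrA.
Qed.

(** The difference quotient converges at a linear rate, uniformly in x: an exact identity writes the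
    error as a Lipschitz increment plus a quadratic remainder divided by s - t. *)
Lemma bsol_time_derivative : exists K, forall s t,
  c <= cos (kappa * s) -> c <= cos (kappa * t) -> s != t ->
  dominated (fun x => RC (s - t)^-1 * (bsol s x - bsol t x) - bsol_t t x)
    (K * `|s - t|).
Proof.
have [CV hV] := regular_nV.
pose C2 := 2 * al ^+ 2 ^+ 2 + 2 * be ^+ 2 ^+ 2.
pose W t x := RC al ^+ 2 * nP t x + RC be ^+ 2 * nQ t x.
have [CW hW] : regular W.
  by apply: regularD; apply: regularZ; [exact: regular_nP|exact: regular_nQ].
exists ((CW * CV * CV + C2 * CV * CV) * envelope) => s t hs ht st.
have st0 : s - t != 0 by rewrite subr_eq0.
have cs0 := lt_le_trans c_gt0 hs; have ct0 := lt_le_trans c_gt0 ht.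
pose h := RC (s - t).
have h0 : h != 0 by rewrite RC_neq0.
(* The time derivative of [nP + nQ] is - i W, and [r] is its first-order Taylor remainder. *)
pose r x := nP s x + nQ s x - (nP t x + nQ t x) - h * (- I * W t x).
have rC x : Nc (r x) <= C2 * (s - t) ^+ 2.
  have hP := normc_taylor (- al ^+ 2) s t (nP_le1 x).
  have hQ := normc_taylor (- be ^+ 2) s t (nQ_le1 x).
  rewrite -!nPE in hP; rewrite -!nQE in hQ.
  rewrite /C2 mulrDl; rewrite !sqrrN in hP hQ.
  apply: le_trans (lerD hP hQ); apply: le_trans _ (le_normcD _ _).
  rewrite le_eqVlt; apply/orP; left; apply/eqP; congr Nc.
  by rewrite /r /W !rmorphN !rmorphXn; ring.
(* The increment of [nP + nQ] is r - i h W. In the result, the first term is O(|s - t|) because [nV]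
   is Lipschitz, the second because r is O((s - t)^2). *)
have dE x : RC (s - t)^-1 * (bsol s x - bsol t x) - bsol_t t x =
    RC (A / bexp x) * (I * W t x * nV t x * (nV s x - nV t x) - r x / h * nV s
      x * nV t x).
  rewrite !bsolE// bsol_tE// /profile_t -/(W t x) fmorphV -/h.
  have Ds : nP s x + nQ s x != 0.
    by rewrite nPDnQ mulf_neq0 ?invr_eq0 ?bD_neq0// RC_bexp_neq0.
  have Dt : nP t x + nQ t x != 0.
    by rewrite nPDnQ mulf_neq0 ?invr_eq0 ?bD_neq0// RC_bexp_neq0.
  rewrite /r /nV; move: (W t x) (nP s x) (nQ s x) (nP t x) (nQ t x) Ds Dt => w
    p q p' q' Ds Dt.
  by field; rewrite Ds Dt -rmorphB RC_bexp_neq0 andbT.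
move: dE => /funext ->.
rewrite mulrAC; apply: envelope_dominated => x.
have [u1 v1] := hV s t hs ht x; have [u1s _] := hV s s hs hs x.
have [u2 _] := hW s t hs ht x.
rewrite (mulrDl (CW * CV * CV)); apply: le_trans (le_normcD _ _) _; apply: lerD.
  have I1 : Nc I = 1 by rewrite /= expr0n expr1n add0r sqrtr1.
  rewrite !Normc.normcM I1 mul1r -[leRHS]mulrA ler_pM ?mulr_ge0 ?normc_ge0//.
  by rewrite ler_pM ?normc_ge0.
rewrite normcN !Normc.normcM Normc.normcV normc_real.
have rh : Nc (r x) / `|s - t| <= C2 * `|s - t|.
  rewrite ler_pdivrMr ?normr_gt0// -mulrA -expr2 real_normK ?num_real//.
rewrite (_ : C2 * CV * CV * _ = C2 * `|s - t| * CV * CV); last by ring.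
by rewrite ler_pM ?mulr_ge0 ?normc_ge0 ?invr_ge0// ler_pM ?mulr_ge0 ?normc_ge0
  ?invr_ge0.
Qed.

End time_regularity.

(** * The explicit function solves the equation up to the blow-up time *)

Section is_solution_bsol.
Context {R : realType}.
Variables (al be A : R).
Hypotheses (al_gt0 : 0 < al) (al_lt_be : al < be) (A_gt0 : 0 < A)
  (A2 : A ^+ 2 = 2 * (al + be) ^+ 2).
Implicit Types (t x s : R).

Local Notation RC := (real_complex R).
Local Notation I := (Complex 0 1 : R[i]).
Local Notation kappa := (kappa al be).
Local Notation bP := (bP al).
Local Notation bQ := (bQ be).
Local Notation bD := (bD al be).
Local Notation bsol := (bsol al be A).
Local Notation bsol_x := (bsol_x al be A).
Local Notation bsol_xx := (bsol_xx al be A).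
Local Notation bsol_t := (bsol_t al be A).

Let al_le_be : al <= be := ltW al_lt_be.

Definition blowup_time : R := pi / 2 / kappa.

Lemma kappa_gt0 : 0 < kappa.
Proof.
by rewrite divr_gt0// subr_gt0 ltr_pXn2r ?nnegrE ?(ltW al_gt0)// ltW//
  (lt_trans al_gt0).
Qed.

Lemma blowup_time_gt0 : 0 < blowup_time.
Proof. by apply: divr_gt0; [rewrite divr_gt0 ?pi_gt0|exact: kappa_gt0]. Qed.

Lemma cos_time_gt0 t : time_interval blowup_time%:E t -> 0 < cos (kappa * t).
Proof.
move=> [t0]; rewrite lte_fin => tT; apply: cos_gt0_pihalf; apply/andP; split.
  rewrite (@lt_le_trans _ _ 0) ?oppr_lt0 ?divr_gt0 ?pi_gt0//.
  by rewrite mulr_ge0// ltW ?kappa_gt0.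
by rewrite mulrC -ltr_pdivlMr ?kappa_gt0.
Qed.

Lemma ccontinuous_cst (z : R[i]) : ccontinuous (fun=> z).
Proof. exact: is_cderive_continuous (is_cderive_cst z). Qed.

Section fixed_time.
Variable t : R.
Hypothesis ct : 0 < cos (kappa * t).

Let D0 x : bD t x != 0.
Proof. exact: bD_neq0. Qed.

Let cP : ccontinuous (bP t).
Proof. exact: is_cderive_continuous (is_cderive_bP _ t). Qed.

Let cQ : ccontinuous (bQ t).
Proof. exact: is_cderive_continuous (is_cderive_bQ _ t). Qed.

Let cW : ccontinuous (fun x => (bD t x)^-1).
Proof. by apply: ccontinuousV D0 _; exact: ccontinuousD. Qed.

Let cL (z w : R[i]) : ccontinuous (fun x => z * bP t x + w * bQ t x).
Proof.
by apply: ccontinuousD; apply: ccontinuousM => //; exact: ccontinuous_cst.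
Qed.

Lemma ccontinuous_bsol_xx : ccontinuous (bsol_xx t).
Proof.
pose W x := (bD t x)^-1.
pose L x := RC al * bP t x + (- RC be) * bQ t x.
pose M x := RC al ^+ 2 * bP t x + RC be ^+ 2 * bQ t x.
have -> : bsol_xx t = fun x => RC A * (2 * (L x * L x * (W x * W x * W x)) + -1
  * (M x * (W x * W x))).
  apply/funext => x; rewrite /bsol_xx /L /M /W; move: (D0 x);
    move: (bD t x) => d d0.
  by field.
have cLL : ccontinuous L := cL _ _; have cM : ccontinuous M := cL _ _.
have cWW : ccontinuous (fun x => W x * W x) by exact: ccontinuousM.
apply: ccontinuousM; first exact: ccontinuous_cst.
apply: ccontinuousD; (apply: ccontinuousM; first exact: ccontinuous_cst).
  by apply: ccontinuousM; [exact: ccontinuousM|apply: ccontinuousM].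
exact: ccontinuousM.
Qed.

Lemma ccontinuous_bsol_t : ccontinuous (bsol_t t).
Proof.
pose W x := (bD t x)^-1.
pose M x := RC al ^+ 2 * bP t x + RC be ^+ 2 * bQ t x.
have -> : bsol_t t = fun x => RC A * I * (M x * (W x * W x)).
  apply/funext => x; rewrite /bsol_t /M /W; move: (D0 x);
    move: (bD t x) => d d0.
  by field.
have cM : ccontinuous M := cL _ _.
apply: ccontinuousM; first exact: ccontinuous_cst.
by apply: ccontinuousM => //; exact: ccontinuousM.
Qed.

(** At a fixed time the lower bound c can be cos (kappa t) itself. *)
Let dominated_of g f : regular al be (cos (kappa * t)) g ->
  (forall x, f x = RC (A / bexp al be x) * g t x) -> exists K, dominated f K.
Proof.
move=> /(regular_dominated al_gt0 al_le_be A_gt0)[K hK] fE; exists K.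
by have [h _] := hK t t (lexx _) (lexx _); move=> x; rewrite fE.
Qed.

Lemma L2_bsol : L2 (bsol t).
Proof.
have [K hK] := dominated_of (regular_nV al be ct) (fun x => bsolE A x ct).
apply: dominated_L2 hK; apply: ccontinuous_measurable.
exact: is_cderive_continuous (is_cderive_bsol A D0).
Qed.

Lemma L2_bsol_x : L2 (bsol_x t).
Proof.
have [K hK] := dominated_of (regular_profile_x al be ct) (fun x => bsol_xE A x
  ct).
apply: dominated_L2 hK; apply: ccontinuous_measurable.
exact: is_cderive_continuous (is_cderive_bsol_x A D0).
Qed.

Lemma L2_bsol_xx : L2 (bsol_xx t).
Proof.
have [K hK] := dominated_of (regular_profile_xx al be ct) (fun x => bsol_xxE A
  x ct).
apply: dominated_L2 hK; apply: ccontinuous_measurable.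
exact: ccontinuous_bsol_xx.
Qed.

Lemma L2_bsol_t : L2 (bsol_t t).
Proof.
have [K hK] := dominated_of (regular_profile_t al be ct) (fun x => bsol_tE A x
  ct).
apply: dominated_L2 hK; apply: ccontinuous_measurable.
exact: ccontinuous_bsol_t.
Qed.

Lemma H1C1_bsol : H1C1 (bsol t) (bsol_x t).
Proof.
split; [exact: is_cderive_bsol| |exact: L2_bsol|exact: L2_bsol_x].
exact: is_cderive_continuous (is_cderive_bsol_x A D0).
Qed.

Lemma H1C1_bsol_x : H1C1 (bsol_x t) (bsol_xx t).
Proof.
split; [exact: is_cderive_bsol_x| |exact: L2_bsol_x|exact: L2_bsol_xx].
exact: ccontinuous_bsol_xx.
Qed.

Lemma bsol_weak_equation v : H1 v ->
  I * Hm1_of_fun (bsol_t t) v + Hm1_dxx (bsol t) v +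
  Hm1_of_fun (nonlinearity (bsol t)) v = 0.
Proof.
move=> Hv; have [v2 _] := Hv; rewrite (H1C1_Hm1_dxx H1C1_bsol H1C1_bsol_x Hv).
have it := L2_cintegrable L2_bsol_t v2; have ix := L2_cintegrable L2_bsol_xx v2.
rewrite /Hm1_of_fun -cintegralZ// -cintegralD//; last exact: cintegrableZ.
(* The pointwise equation expresses the cubic term through u_t and u_xx, from which it inherits
   integrability against [v]. *)
have -> : (fun x => nonlinearity (bsol t) x * v x) =
    (fun x => -1 * (I * (bsol_t t x * v x) + bsol_xx t x * v x)).
  apply/funext => x; have /eqP := bsol_equation A2 (D0 x).
  by rewrite addrC addr_eq0 => /eqP ->; ring.
rewrite cintegralZ; last by apply: cintegrableD => //; exact: cintegrableZ.
by rewrite mulN1r subrr.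
Qed.

End fixed_time.

Lemma H1C1B (f f' g g' : R -> R[i]) : H1C1 f f' -> H1C1 g g' ->
  H1C1 (f \- g) (f' \- g').
Proof.
have NE (h : R -> R[i]) : (fun x => - h x) = fun x => -1 * h x.
  by apply/funext => x; rewrite mulN1r.
have BE (h k : R -> R[i]) : (fun x => h x + -1 * k x) = h \- k.
  by apply/funext => x; rewrite mulN1r.
move=> [d1 c1 l1 k1] [d2 c2 l2 k2]; split; [| |exact: L2B|exact: L2B].
- have := is_cderiveD d1 (is_cderiveZ (-1) d2).
  by rewrite !BE.
- apply: ccontinuousD => //; rewrite NE.
  by apply: ccontinuousM => //; exact: ccontinuous_cst.
Qed.

(** Half the value at t is a lower bound c valid at all nearby times, as [regular] demands. *)
Lemma near_cos t : 0 < cos (kappa * t) ->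
  \forall s \near t, cos (kappa * t) / 2 <= cos (kappa * s).
Proof.
move=> ct; have h : cos (kappa * s) @[s --> t] --> cos (kappa * t).
  apply: (@continuous_comp _ _ _ (fun s => kappa * s) cos);
    last exact: continuous_cos.
  by apply: cvgMl_tmp; exact: cvg_id.
by apply: (cvgr_ge _ h); rewrite ltr_pdivrMr// ltr_pMr// ltr1n.
Qed.

Lemma cvg_time_bound (K t : R) : K * `|s - t| @[s --> t] --> (0 : R).
Proof.
have h0 : s - t @[s --> t] --> t - t by apply: cvgB;
  [exact: cvg_id|exact: cvg_cst].
rewrite subrr in h0; have h1 := cvg_norm h0; rewrite normr0 in h1.
by rewrite -[X in _ --> X](mulr0 K); exact: (cvgMl_tmp (h1 _)).
Qed.

Lemma dominated_le (f : R -> R[i]) (K L : R) : K <= L -> dominated f K ->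
  dominated f L.
Proof. by move=> KL fK x; rewrite (le_trans (fK x))// ler_wpM2r. Qed.

Lemma bsol_continuous_H1 : continuous_H1 blowup_time%:E bsol.
Proof.
split=> [t /cos_time_gt0 ct|t It]; first exact: H1C1_H1 (H1C1_bsol ct).
have ct := cos_time_gt0 It; pose c := cos (kappa * t) / 2.
have c0 : 0 < c by rewrite divr_gt0.
have hct : c <= cos (kappa * t) by rewrite ler_pdivrMr// ler_pMr// ler1n.
have [K1 h1] := regular_dominated al_gt0 al_le_be A_gt0 (regular_nV al be c0).
have [K2 h2] := regular_dominated al_gt0 al_le_be A_gt0 (regular_profile_x al
  be c0).
pose K := Num.max K1 K2.
pose B := K * Num.sqrt (2 * @oneDsqrV_mass R).
apply: (squeeze_cvgr (f := fun=> 0) (h := fun s => B * `|s - t|)).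
- have := near_cos ct; apply: filterS => s cs /cos_time_gt0 cs0;
  rewrite H1norm_ge0/=.
  rewrite /B mulrAC.
  apply: (H1C1_H1norm_le (H1C1B (H1C1_bsol cs0) (H1C1_bsol ct))).
    apply: (@dominated_le _ (K1 * `|s - t|));
      first by rewrite ler_wpM2r// le_max lexx.
    have [_ h] := h1 s t cs hct; move=> x; have := h x.
    by rewrite -!bsolE.
  apply: (@dominated_le _ (K2 * `|s - t|));
    first by rewrite ler_wpM2r// le_max lexx orbT.
  have [_ h] := h2 s t cs hct; move=> x; have := h x.
  by rewrite -!bsol_xE.
- exact: cvg_cst.
- by apply: cvg_within_filter; exact: cvg_time_bound.
Qed.

(** The error of the difference quotient is represented by a function dominated at rate |s - t|;
    [Hm1norm_le] transfers this rate to the norm of H^{-1}. *)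
Lemma bsol_Hm1_derivative t : time_interval blowup_time%:E t ->
  is_Hm1_derivative blowup_time%:E bsol t (Hm1_of_fun (bsol_t t)).
Proof.
move=> It; have ct := cos_time_gt0 It; pose c := cos (kappa * t) / 2.
have c0 : 0 < c by rewrite divr_gt0.
have hct : c <= cos (kappa * t) by rewrite ler_pdivrMr// ler_pMr// ler1n.
have [K hK] := bsol_time_derivative al_gt0 al_le_be A_gt0 c0.
rewrite /is_Hm1_derivative.
pose B := K * (@oneDsqrV_mass R + 1).
apply: (squeeze_cvge (f := fun=> 0%E) (h := fun s => (B * `|s - t|)%:E)).
- have := near_cos ct; apply: filterS => s cs st /cos_time_gt0 cs0.
  rewrite Hm1norm_ge0/= /B mulrAC.
  have l1 := L2B (L2_bsol cs0) (L2_bsol ct); have lt := L2_bsol_t ct.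
  apply: Hm1norm_le (hK s t cs hct st) _.
    apply: L2_cmeasurable; apply: L2D; last exact: L2N.
    exact: L2Z.
  move=> v [v2 _]; rewrite /Hm1_of_fun.
  have i1 := L2_cintegrable l1 v2; have i2 := L2_cintegrable lt v2.
  rewrite -(cintegralZ _ i1) -[- cintegral _]mulN1r -(cintegralZ _ i2).
  rewrite -cintegralD; [|exact: cintegrableZ..].
  by congr cintegral; apply/funext => x; rewrite fmorphV/=; ring.
- exact: cvg_cst.
- apply: cvg_within_filter; apply: cvg_within_filter.
  apply: cvg_EFin; first exact: nearW.
  exact: cvg_time_bound.
Qed.

Lemma is_solution_bsol : is_solution (bsol 0) blowup_time%:E bsol.
Proof.
split; [by rewrite lte_fin blowup_time_gt0|exact: bsol_continuous_H1|exact: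
  nearW|].
move=> t It; exists (Hm1_of_fun (bsol_t t)); split.
  exact: bsol_Hm1_derivative.
by move=> v; exact: (bsol_weak_equation (cos_time_gt0 It)).
Qed.

End is_solution_bsol.

(** * Blow-up *)

Section norm_lower_bounds.
Context {R : realType}.
Notation mu := (@lebesgue_measure R).
Implicit Types (f : R -> R[i]) (c tau : R).

Lemma lebesgue_itv0 tau : 0 < tau -> mu `[0, tau] = tau%:E.
Proof. by move=> tau0; rewrite lebesgue_measure_itv/= lte_fin tau0 oppr0 adde0.
  Qed.

Lemma L2norm_ge f c tau : L2 f -> 0 <= c -> 0 < tau ->
  (forall x, 0 <= x <= tau -> c <= Normc.normc (f x)) ->
  c ^+ 2 * tau <= L2norm f ^+ 2.
Proof.
move=> f2 c0 tau0 fc; rewrite sqr_L2norm//; have ic := integrable_cabs2 f2.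
rewrite -lee_fin /Rintegral fineK; last exact: integrable_fin_num.
apply: (@le_trans _ _ (\int[mu]_(x in `[0%R, tau]) (cabs2 f x)%:E)%E);
  last first.
  apply: ge0_subset_integral => //; first exact: measurable_int ic.
  by move=> x _; rewrite lee_fin cabs2_ge0.
rewrite EFinM -(lebesgue_itv0 tau0) -integral_cst//.
apply: ge0_le_integral => //.
- by move=> x _; rewrite lee_fin sqr_ge0.
- apply/measurable_EFinP; apply: measurable_funTS.
  by apply/measurable_EFinP; exact: measurable_int ic.
- move=> x /=; rewrite in_itv/= => x0; rewrite lee_fin cabs2E.
  by rewrite lerXn2r ?nnegrE ?normc_ge0// fc.
Qed.

(** An essential bound below c would have an exceptional null set containing [0, tau], whose measure
    is tau > 0. *)
Lemma Linfnorm_ge f c tau : 0 < tau ->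
  (forall x, 0 <= x <= tau -> c <= Normc.normc (f x)) ->
  (c%:E <= Linfnorm f)%E.
Proof.
move=> tau0 fc; rewrite /Linfnorm unlock.
have -> : (0 < mu [set: R])%E.
  by rewrite -set_itvNyy lebesgue_measure_itv /= ltry.
apply: le_ereal_inf_tmp => y /= [N [mN N0 sN]].
rewrite leNgt; apply/negP => yc.
have /(le_measure mu) : `[0, tau] `<=` N.
  move=> x /=; rewrite in_itv/= => x0; apply: sN => /= h.
  have : (y < y)%E.
    apply: lt_le_trans yc _; apply: le_trans _ h.
    by rewrite lee_fin ger0_norm ?normc_ge0// fc.
  by rewrite ltxx.
rewrite !inE => /(_ (measurable_itv _) mN).
move=> h; have : (tau%:E <= 0)%E by rewrite -(lebesgue_itv0 tau0) -N0; exact: h.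
by rewrite lee_fin leNgt tau0.
Qed.

End norm_lower_bounds.

(** * Blow-up of the explicit solution and its maximality *)

Section blow_up.
Context {R : realType}.
Notation mu := (@lebesgue_measure R).
Variables (al be A : R).
Hypotheses (al_gt0 : 0 < al) (al_lt_be : al < be) (A_gt0 : 0 < A)
  (A2 : A ^+ 2 = 2 * (al + be) ^+ 2).
Implicit Types (t x s : R).

Local Notation kappa := (kappa al be).
Local Notation bsol := (bsol al be A).
Local Notation T := (blowup_time al be).

Let be_gt0 : 0 < be := lt_trans al_gt0 al_lt_be.

(** With tau = cos (kappa t) and 0 <= x <= tau, both terms of [sqr_normc_bD] are O(tau^2): the first
    through its cosine, the second because |P| and |Q| are both 1 at x = 0 and so differ by O(x). *)
Lemma normc_bsol_ge : exists2 k : R, 0 < k & forall t x,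
  0 < cos (kappa * t) -> 0 <= x <= cos (kappa * t) ->
  k / cos (kappa * t) <= Normc.normc (bsol t x).
Proof.
(* For x in [0, 1], 2 e^al bounds |P| + |Q|, and al e^al + be bounds the slope of |P| - |Q|. *)
pose K := 2 * expR al + (al * expR al + be).
have K0 : 0 < K by rewrite addr_gt0 ?mulr_gt0 ?expR_gt0// addr_gt0// mulr_gt0
  ?expR_gt0.
exists (A / K); first exact: divr_gt0.
move=> t x; set tau := cos (kappa * t) => tau0 /andP[x0 xtau].
have x1 : x <= 1 by apply: le_trans xtau _;
  exact: le_trans (ler_norm _) (cos_max _).
have D0 : 0 < Normc.normc (bD al be t x).
  rewrite lt_def normc_ge0 andbT; apply/eqP => /Normc.eq0_normc.
  by apply/eqP; exact: bD_neq0.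
rewrite /bsol Normc.normcM Normc.normcV normc_real (gtr0_norm A_gt0) -mulrA
  -invfM.
rewrite ler_wpM2l ?(ltW A_gt0)// lef_pV2 ?posrE ?mulr_gt0//.
rewrite -(ler_pXn2r (n := 2)) ?nnegrE ?normc_ge0 ?mulr_ge0 ?(ltW K0) ?(ltW
  tau0)//.
rewrite sqr_normc_bD -/tau.
have p1 : 1 <= expR (al * x) by rewrite -expR0 ler_expR mulr_ge0// ltW.
have pal : expR (al * x) <= expR al by rewrite ler_expR ler_piMr// ltW.
have q1 : expR (- (be * x)) <= 1 by rewrite -expR0 ler_expR oppr_le0 mulr_ge0//
  ltW.
have q0 := expR_gt0 (- (be * x)).
(* e^y - 1 <= y e^y, obtained from e^{-y} >= 1 - y with y = al x. *)
have pB : expR (al * x) - 1 <= al * expR al * x.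
  have := expR_ge1Dx (- (al * x)); rewrite expRN => h.
  have : expR (al * x) * (1 - al * x) <= 1.
    by rewrite -ler_pdivlMl ?expR_gt0// mulr1.
  have ax : 0 <= al * x by rewrite mulr_ge0// ltW.
  nra.
have qB : 1 - expR (- (be * x)) <= be * x.
  by have := expR_ge1Dx (- (be * x)); lra.
have s1 : sin (kappa * t) ^+ 2 <= 1.
  by have := cos2Dsin2 (kappa * t); have := sqr_ge0 (cos (kappa * t)); lra.
move: p1 pal q1 q0 pB qB s1; set p := expR (al * x); set q := expR (- (be * x)).
set e := expR al; set S := sin _ ^+ 2 => p1 pal q1 q0 pB qB s1.
have pq0 : 0 <= p - q by lra.
have ee : 1 <= e := le_trans p1 pal.
have pq1 : p - q <= (al * e + be) * tau.
  have : p - q <= (al * e + be) * x by lra.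
  move/le_trans; apply; apply: ler_wpM2l => //.
  by rewrite addr_ge0 ?mulr_ge0 ?(ltW al_gt0) ?(ltW be_gt0)// (le_trans _ ee).
have h1 : (p + q) ^+ 2 * tau ^+ 2 <= (2 * e * tau) ^+ 2.
  have e2 : (p + q) * tau <= 2 * e * tau by rewrite ler_wpM2r ?(ltW tau0)//;
    lra.
  have pq : 0 <= (p + q) * tau by rewrite mulr_ge0 ?(ltW tau0)//; lra.
  by rewrite -exprMn lerXn2r ?nnegrE// (le_trans pq).
have h2 : (p - q) ^+ 2 * S <= ((al * e + be) * tau) ^+ 2.
  apply: (@le_trans _ _ ((p - q) ^+ 2)); first by rewrite ler_piMr ?sqr_ge0.
  by rewrite lerXn2r ?nnegrE// (le_trans pq0).
apply: le_trans (lerD h1 h2) _.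
have -> : K * tau = 2 * e * tau + (al * e + be) * tau by rewrite -mulrDl.
have u0 : 0 <= 2 * e * tau by rewrite mulr_ge0 ?(ltW tau0)//; lra.
have v0 : 0 <= (al * e + be) * tau by exact: le_trans pq1.
by move: (2 * e * tau) ((al * e + be) * tau) u0 v0 => u v u0 v0; nra.
Qed.

Lemma near_blowup_time (e : R) : 0 < e ->
  \forall t \near T^'-, time_interval T%:E t /\ cos (kappa * t) < e.
Proof.
move=> e0; have k0 := kappa_gt0 al_gt0 al_lt_be.
have T0 := blowup_time_gt0 al_gt0 al_lt_be.
have h : cos (kappa * s) @[s --> T] --> cos (kappa * T).
  apply: (@continuous_comp _ _ _ (fun s => kappa * s) cos);
    last exact: continuous_cos.
  by apply: cvgMl_tmp; exact: cvg_id.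
have kT : kappa * T = pi / 2 by rewrite /blowup_time mulrC divfK// gt_eqF.
rewrite kT cos_pihalf in h.
have h1 : \forall t \near T^'-, cos (kappa * t) < e.
  exact: (cvgr_lt _ (cvg_at_left_filter h) _ e0).
have h2 : \forall t \near T^'-, 0 <= t by exact: nbhs_left_ge.
have h3 : \forall t \near T^'-, t < T by exact: nbhs_left_lt.
by near=> t; split; [split; [|rewrite lte_fin]|]; near: t.
Unshelve. all: by end_near. Qed.

Lemma blows_up_bsol : blows_up_at T%:E bsol.
Proof.
split; first exact: ltry.
have [k k0 hk] := normc_bsol_ge.
apply/eqP; rewrite eq_le leey/= limf_esupE;
  apply: le_ereal_inf_tmp => _ /= [V TV <-].
rewrite leye_eq; apply/eqP/eq_infty => M.
(* cos (kappa t) < e makes k / cos (kappa t) larger than |M| + 1. *)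
pose e := k / (`|M| + 1).
have e0 : 0 < e by rewrite divr_gt0// ltr_wpDl.
have [t [Vt [It te]]] := filter_ex (filterI TV (near_blowup_time e0)).
have ct := cos_time_gt0 al_gt0 al_lt_be It.
apply: (@le_trans _ _ (Linfnorm (bsol t))); last by apply: ereal_sup_ubound;
  exists t.
apply: le_trans _ (Linfnorm_ge ct (fun x hx => hk t x ct hx)).
rewrite lee_fin ler_pdivlMr//.
move: te; rewrite /e ltr_pdivlMr ?ltr_wpDl// => /ltW; apply: le_trans.
rewrite mulrC ler_wpM2l ?(ltW ct)//; have := ler_norm M; lra.
Qed.

(* By [L2norm_ge] the square of the L2 norm is at least k ^ 2 / cos (kappa s),
   whereas an extension has bounded L2 norm near the blow-up time. *)
Lemma bsol_not_extendable : ~ exists (T' : \bar R) (v : R -> R -> R[i]),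
  [/\ (T%:E < T')%E, is_solution (bsol 0) T' v
    & forall t, time_interval T%:E t -> v t = bsol t %[ae mu]].
Proof.
move=> [T' [v [TT' [_ [vH1 vcont] _ _] vu]]].
have T0 := blowup_time_gt0 al_gt0 al_lt_be.
have IT : time_interval T' T by split; [exact: ltW|].
have [vT2 _] := vH1 _ IT.
have [k k0 hk] := normc_bsol_ge.
(* By continuity at T, 2 + 2 |v(T)|^2 bounds the squared L2 norm at times just before T; one more
   unit makes the contradiction strict. *)
pose M := 3 + 2 * L2norm (v T) ^+ 2.
have M0 : 0 < M by rewrite ltr_wpDr// mulr_ge0// sqr_ge0.
have e0 : 0 < k ^+ 2 / M by rewrite divr_gt0// exprn_gt0.
have h1 : \forall s \near T^'-, time_interval T' s -> H1norm (v s \- v T) < 1.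
  have h0 : nbhs T (fun s => time_interval T' s -> H1norm (v s \- v T) < 1).
    exact: (cvgr_lt _ (vcont _ IT) _ ltr01).
  exact: (cvg_within (fun s => s < T) h0).
have [s [h [Is se]]] := @filter_ex _ _ (at_left_proper_filter T) _ (filterI h1
  (near_blowup_time e0)).
have Is' : time_interval T' s.
  by case: Is => s0 sT; split => //; exact: lt_trans TT'.
have cs := cos_time_gt0 al_gt0 al_lt_be Is.
have us2 : L2 (bsol s) := L2_bsol al_gt0 al_lt_be A_gt0 cs.
have [vs2 _] := vH1 _ Is'.
have vB : L2norm (v s \- v T) <= 1.
  by apply: ltW; exact: le_lt_trans (L2norm_le_H1norm _) (h Is').
have := L2norm_triangle vs2 vT2.
have vs : {ae mu, forall x, v s x = bsol s x}.
  have := vu _ Is; apply: filterS; first exact: (ae_filter_ringOfSetsType mu).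
  by move=> x; apply.
rewrite (ae_eq_L2norm vs2 us2 vs).
have kc : 0 <= k / cos (kappa * s) by rewrite divr_ge0// ltW.
have := L2norm_ge us2 kc cs (fun x hx => hk s x cs hx).
have -> : (k / cos (kappa * s)) ^+ 2 * cos (kappa * s) = k ^+ 2 / cos (kappa *
  s).
  by field; rewrite gt_eqF.
have : M < k ^+ 2 / cos (kappa * s).
  by rewrite ltr_pdivlMr// mulrC -ltr_pdivlMr.
have : L2norm (v s \- v T) ^+ 2 <= 1 by rewrite expr_le1 ?L2norm_ge0.
rewrite /M; lra.
Qed.

Lemma is_maximal_solution_bsol : is_maximal_solution (bsol 0) T%:E bsol.
Proof. by split; [exact: is_solution_bsol|exact: bsol_not_extendable]. Qed.

End blow_up.

(** * Distance to the soliton *)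

Section soliton_distance.
Context {R : realType}.
Variables (a d A : R).
Hypotheses (a_gt0 : 0 < a) (d_gt0 : 0 < d) (d_small : d <= a / 4) (A_gt0 : 0 <
  A).
Implicit Types (x : R).

Local Notation RC := (real_complex R).

(** Twice the hyperbolic cosine of a x, so that [sech] is half the hyperbolic secant. *)
Let ch x := expR (a * x) + expR (- (a * x)).
Let sech x := (ch x)^-1.
Let sech' x := - (a * (expR (a * x) - expR (- (a * x)))) * (sech x * sech x).

Lemma is_derive_expZ (k x : R) :
  is_derive x 1 (fun y => expR (k * y)) (k * expR (k * x)).
Proof.
apply: is_derive_eq (is_derive_compf (is_derive_expR _)
  (is_derive_mulf (is_derive_cstf k x) (is_derive_idf x))) _.
by ring.
Qed.

Let ch_gt0 x : 0 < ch x.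
Proof. by rewrite addr_gt0 ?expR_gt0. Qed.

Let sech_ge0 x : 0 <= sech x.
Proof. by rewrite invr_ge0 ltW. Qed.

Let is_derive_ch x : is_derive x 1 ch (a * (expR (a * x) - expR (- (a * x)))).
Proof.
have h : is_derive x 1 (fun y => expR (- (a * y))) (- a * expR (- a * x)).
  have -> : (fun y => expR (- (a * y))) = (fun y => expR (- a * y)).
    by apply/funext => y; rewrite mulNr.
  exact: is_derive_expZ.
by apply: is_derive_eq (is_derive_addf (is_derive_expZ a x) h) _;
  rewrite !mulNr; ring.
Qed.

Let is_derive_sech x : is_derive x 1 sech (sech' x).
Proof.
have c0 : ch x != 0 by rewrite gt_eqF.
apply: is_derive_eq (@is_derive_invf _ ch x _ c0 (is_derive_ch x)) _.
by rewrite /sech' /sech; field.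
Qed.

Let sech_le x : sech x <= expR (- (a * `|x|)).
Proof.
rewrite expRN lef_pV2 ?posrE ?expR_gt0//; have [x0|x0] := leP 0 x.
  by rewrite (ger0_norm x0) lerDl expR_ge0.
by rewrite (ltr0_norm x0) mulrN lerDr expR_ge0.
Qed.

(** [sech'] is - a tanh (a x) times [sech], and |tanh| <= 1. *)
Let norm_sech'_le x : `|sech' x| <= a * sech x.
Proof.
rewrite normrM normrN !normrM (gtr0_norm a_gt0) (ger0_norm (sech_ge0 x)) -mulrA.
rewrite ler_wpM2l ?(ltW a_gt0)// mulrA ler_piMl//.
rewrite ler_pdivrMr// mul1r ler_norml /ch.
have := expR_gt0 (a * x); have := expR_gt0 (- (a * x)) => h1 h2.
by apply/andP; split; lra.
Qed.

(** For the amplitude A of the soliton this is phi_omega (1 - e^{d x}), the soliton minus the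
    initial datum. *)
Let f x := A * ((1 - expR (d * x)) * sech x).
Let f' x := A * (- (d * expR (d * x)) * sech x + (1 - expR (d * x)) * sech' x).

Let is_derive_f x : is_derive x 1 f (f' x).
Proof.
have h1 := is_derive_subf (is_derive_cstf 1 x) (is_derive_expZ d x).
apply: is_derive_eq (is_derive_mulf (is_derive_cstf A x) (is_derive_mulf h1
  (is_derive_sech x))) _.
by rewrite mul0r add0r sub0r.
Qed.

Let continuous_f' : continuous f'.
Proof.
have cs := is_derive_continuous is_derive_sech.
have ce k := is_derive_continuous (is_derive_expZ k).
have cem : continuous (fun x => expR (- (a * x))).
  have -> : (fun y => expR (- (a * y))) = (fun y => expR (- a * y)).
    by apply/funext => y; rewrite mulNr.
  exact: ce.
have cs' : continuous sech'.
  move=> x; apply: cvgM; last exact: (cvgM (cs x) (cs x)).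
  by apply: cvgN; apply: cvgMl_tmp; apply: cvgB; [exact: ce|exact: cem].
move=> x; apply: cvgMl_tmp; apply: cvgD.
  by apply: cvgM; [apply: cvgN; apply: cvgMl_tmp; exact: ce|exact: cs].
by apply: cvgM; [apply: cvgB; [exact: cvg_cst|exact: ce]|exact: cs'].
Qed.

Let expR_d_le x : expR `|d * x| <= expR (a * `|x| / 4).
Proof.
rewrite ler_expR normrM (gtr0_norm d_gt0) mulrAC.
by rewrite ler_wpM2r.
Qed.

(** The mean value theorem gives |d x| e^{|d x|}; |x| is absorbed by a second factor e^{a|x|/4}. The
    total growth e^{a|x|/2} costs half the decay of [sech]. *)
Let norm_1BexpR_le x : `|1 - expR (d * x)| <= d * (4 / a) * expR (a * `|x| / 2).
Proof.
have := @is_derive_bounded R (fun x => expR x - 1) expR (expR `|d * x|) (d * x).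
rewrite expR0 subrr distrC => h.
apply: (@le_trans _ _ (expR `|d * x| * `|d * x|)).
  apply: h => //.
  - move=> y; apply: is_derive_eq (is_derive_subf (is_derive_expR y)
    (is_derive_cstf 1 y)) _.
    by rewrite subr0.
  - by move=> y yx; rewrite ger0_norm ?expR_ge0// ler_expR (le_trans (ler_norm
    y)).
have -> : a * `|x| / 2 = a * `|x| / 4 + a * `|x| / 4 by field.
have xle : `|d * x| <= d * (4 / a) * expR (a * `|x| / 4).
  rewrite normrM (gtr0_norm d_gt0) -mulrA ler_wpM2l ?(ltW d_gt0)//.
  have := expR_ge1Dx (a * `|x| / 4) => e1.
  rewrite mulrAC ler_pdivlMr// mulrC (le_trans _ (_ : 4 * (a * `|x| / 4) <=
    _))//.
    by rewrite mulrCA divff// mulr1.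
  rewrite ler_wpM2l//; lra.
by rewrite expRD [leLHS]mulrC mulrA ler_pM ?expR_ge0.
Qed.

(** The constant of [expRN_norm_le] at b = a / 2, the decay rate that remains. *)
Let K := 1 + 4 / (a / 2) ^+ 2.

Let decay x : expR (a * `|x| / 2) * sech x <= K * (oneDsqr x)^-1.
Proof.
apply: le_trans (expRN_norm_le x (divr_gt0 a_gt0 (ltr0Sn _ 1))).
apply: (@le_trans _ _ (expR (a * `|x| / 2) * expR (- (a * `|x|)))).
  by rewrite ler_wpM2l ?expR_ge0.
by rewrite -expRD ler_expR; lra.
Qed.

Let norm_f_le x : `|f x| <= A * (4 / a) * K * d * (oneDsqr x)^-1.
Proof.
rewrite normrM (gtr0_norm A_gt0) normrM (ger0_norm (sech_ge0 x)) -!mulrA.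
rewrite ler_wpM2l ?(ltW A_gt0)//.
apply: (@le_trans _ _ (d * (4 / a) * (expR (a * `|x| / 2) * sech x))).
  by rewrite mulrA ler_wpM2r.
rewrite [leRHS](_ : _ = d * (4 / a) * (K * (oneDsqr x)^-1)); last by ring.
apply: ler_wpM2l (decay x); apply: mulr_ge0; first exact: ltW.
by apply: divr_ge0; last exact: ltW.
Qed.

(** 5 = 1 + 4: the derivative of e^{d x} contributes 1; in the other term the factor a of the bound
    on [sech'] cancels the denominator of 4 / a. *)
Let norm_f'_le x : `|f' x| <= A * 5 * K * d * (oneDsqr x)^-1.
Proof.
have e1 : `|- (d * expR (d * x)) * sech x| <= d * (K * (oneDsqr x)^-1).
  rewrite normrM normrN normrM (gtr0_norm d_gt0) (ger0_norm (sech_ge0 x)).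
  rewrite (ger0_norm (expR_ge0 _)) -mulrA ler_wpM2l ?(ltW d_gt0)//.
  apply: le_trans (decay x); rewrite ler_wpM2r//.
  apply: (@le_trans _ _ (expR `|d * x|)); first by rewrite ler_expR ler_norm.
  apply: le_trans (expR_d_le x) _; rewrite ler_expR.
  have : 0 <= a * `|x| by rewrite mulr_ge0// ltW.
  by lra.
have e2 : `|(1 - expR (d * x)) * sech' x| <= 4 * d * (K * (oneDsqr x)^-1).
  rewrite normrM.
  apply: le_trans (ler_pM (normr_ge0 _) (normr_ge0 _) (norm_1BexpR_le x)
    (norm_sech'_le x)) _.
  rewrite (_ : _ * (a * _) = 4 * d * (expR (a * `|x| / 2) * sech x));
    last first.
    by field; rewrite gt_eqF.
  by rewrite ler_wpM2l ?mulr_ge0 ?(ltW d_gt0).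
rewrite normrM (gtr0_norm A_gt0) -!mulrA ler_wpM2l ?(ltW A_gt0)//.
rewrite [leRHS](_ : _ = d * (K * (oneDsqr x)^-1) + 4 * d * (K * (oneDsqr
  x)^-1)); last by ring.
exact: le_trans (ler_normD _ _) (lerD e1 e2).
Qed.

Lemma H1norm_soliton_perturbation :
  H1norm (fun x => RC (A * ((1 - expR (d * x)) * (expR (a * x) + expR (- (a *
    x)))^-1)))
  <= A * (5 + 4 / a) * (1 + 4 / (a / 2) ^+ 2) * Num.sqrt (2 * @oneDsqrV_mass R)
    * d.
Proof.
(* The sum 5 + 4 / a covers the constant 4 / a for [f] and the constant 5 for [f']. *)
pose B := A * (5 + 4 / a) * K * d.
have w0 x : 0 <= (oneDsqr x)^-1 by [].
have K0 : 0 <= K by rewrite addr_ge0 ?divr_ge0 ?sqr_ge0.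
have a40 : 0 <= 4 / a by rewrite divr_ge0// ltW.
have hf : dominated (fun x => RC (f x)) B.
  move=> x; rewrite normc_real; apply: le_trans (norm_f_le x) _.
  rewrite ler_wpM2r// ler_wpM2r ?(ltW d_gt0)// ler_wpM2r// ler_wpM2l ?(ltW
    A_gt0)//.
  by rewrite lerDr.
have hf' : dominated (fun x => RC (f' x)) B.
  move=> x; rewrite normc_real; apply: le_trans (norm_f'_le x) _.
  rewrite ler_wpM2r// ler_wpM2r ?(ltW d_gt0)// ler_wpM2r// ler_wpM2l ?(ltW
    A_gt0)//.
  by rewrite lerDl.
have cR (h : R -> R) : continuous h -> ccontinuous (fun x => RC (h x)).
  by move=> ch'; split => //; exact: cst_continuous.
have H : H1C1 (fun x => RC (f x)) (fun x => RC (f' x)).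
  split.
  - by move=> x; split => /=; [exact: is_derive_f|exact: is_derive_cst].
  - exact: cR continuous_f'.
  - apply: dominated_L2 hf; apply: ccontinuous_measurable; apply: cR.
    exact: is_derive_continuous is_derive_f.
  - by apply: dominated_L2 hf'; apply: ccontinuous_measurable; exact: cR.
apply: le_trans (H1C1_H1norm_le H hf hf') _.
by rewrite /B /K mulrAC.
Qed.

End soliton_distance.

Theorem theorem3 (R : realType) (omega : R) (omega_gt0 : 0 < omega)
    (eps : R) (eps_gt0 : 0 < eps) :
  exists q : R -> R[i],
    [/\ H1 q,
        H1norm (soliton omega \- q) < eps
      & exists (T : \bar R) (u : R -> R -> R[i]),
          is_maximal_solution q T u /\ blows_up_at T u].
Proof.
pose a := Num.sqrt omega; have a0 : 0 < a by rewrite sqrtr_gt0.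
have aE : a ^+ 2 = omega by rewrite sqr_sqrtr// ltW.
pose A := 2 * Num.sqrt (2 * omega).
have A0 : 0 < A by rewrite mulr_gt0// sqrtr_gt0 mulr_gt0.
have AE : A ^+ 2 = 8 * a ^+ 2.
  by rewrite exprMn sqr_sqrtr ?mulr_ge0 ?ltW// aE; ring.
pose B := A * (5 + 4 / a) * (1 + 4 / (a / 2) ^+ 2) * Num.sqrt (2 *
  @oneDsqrV_mass R).
have B0 : 0 <= B.
  by rewrite !mulr_ge0 ?addr_ge0 ?divr_ge0 ?sqr_ge0 ?sqrtr_ge0 ?(ltW A0) ?(ltW
    a0).
(* The bound a / 4 keeps al positive and leaves enough decay; the denominator B + 1 makes B d < eps
   even when B is 0. *)
pose d := Num.min (a / 4) (eps / (B + 1)).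
have d0 : 0 < d by rewrite lt_min !divr_gt0//= ltr_wpDl.
have da : d <= a / 4 by rewrite ge_min lexx.
have al0 : 0 < a - d by lra.
have alb : a - d < a + d by lra.
(* al + be = 2 a for every d, so the amplitude of the soliton is the one the equation requires. *)
have A2 : A ^+ 2 = 2 * ((a - d) + (a + d)) ^+ 2 by rewrite AE; ring.
exists (bsol (a - d) (a + d) A 0); split.
- have T0 := blowup_time_gt0 al0 alb.
  have [_ [h _] _ _] := is_solution_bsol al0 alb A0 A2.
  by apply: h; split.
(* At t = 0 both phases are trivial and P + Q = e^{-d x} (e^{a x} + e^{-a x}). *)
- have -> : soliton omega \- bsol (a - d) (a + d) A 0 = fun x => real_complex R
      (A * ((1 - expR (d * x)) * (expR (a * x) + expR (- (a * x)))^-1)).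
    apply/funext => x /=; rewrite /soliton -/a -/A /bsol /bD /bP /bQ !mulr0
      !oppr0 cis0 !mulr1.
    rewrite -rmorphD -fmorph_div -rmorphB; congr real_complex_def.
    have -> : (a - d) * x = - (d * x) + a * x by ring.
    have -> : - ((a + d) * x) = - (d * x) + - (a * x) by ring.
    rewrite !expRD (expRN (d * x)); move: (expR_gt0 (d * x)) (expR_gt0 (a * x))
      (expR_gt0 (- (a * x))).
    move: (expR _) (expR _) (expR _) => u v w u0 v0 w0; field.
    by rewrite !gt_eqF ?addr_gt0 ?mulr_gt0.
  apply: le_lt_trans (H1norm_soliton_perturbation a0 d0 da A0) _.
  rewrite -/B; apply: (@le_lt_trans _ _ (B * (eps / (B + 1)))).
    by rewrite ler_wpM2l// ge_min lexx orbT.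
  by rewrite mulrA ltr_pdivrMr ?ltr_wpDl// mulrC ltr_pM2l// ltrDl.
- exists (blowup_time (a - d) (a + d))%:E, (bsol (a - d) (a + d) A); split.
    exact: is_maximal_solution_bsol.
  exact: blows_up_bsol.
Qed.
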